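(* Let $n\ge1$ and let $\mathcal E$ be a metrizable commutative topological ring containing $\mathbb Q$ with the same unit; let $\overline{\mathbb Z}$ be the closure of $\mathbb Z$ in $\mathcal E$. Let $\mathrm{Fr}_n^\circ(\mathcal E)$ be the topological group of all $g\in\mathrm{Afr}_n(\mathcal E)$ with constant term $1$ satisfying $\delta(g)=g\otimes g$, let $\mathrm{Fr}_n^\circ[\mathcal E,\overline{\mathbb Z}]$ be the subgroup of those $g$ all of whose coefficients lie in $\overline{\mathbb Z}$, and let $F_n\subset\mathrm{Fr}_n^\circ(\mathcal E)$ be the (free) subgroup generated by $1+\omega_1,\dots,1+\omega_n$. Then: (a) The closure of $F_n$ in $\mathrm{Fr}_n^\circ(\mathcal E)$ coincides with $\mathrm{Fr}_n^\circ[\mathcal E,\overline{\mathbb Z}]$. (b) The closure of $F_n$ in $\mathrm{Fr}_n^\circ(\mathcal E)$ consists of all products $$\prod_{L}\Xi_L(1+\omega_1,\dots,1+\omega_n)^{t_L},\qquad t_L\in\overline{\mathbb Z},$$ where $L$ ranges over all Lyndon words in $a_1,\dots,a_n$ and the factors are written from left to right in increasing order with respect to $\lessdot$.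
   Context: Addition and multiplication in $\mathcal E$ are assumed jointly continuous. $\mathrm{Afr}_n(\mathcal E)$ is the algebra of formal noncommutative associative series $\sum_\alpha c_\alpha\omega^\alpha$, $c_\alpha\in\mathcal E$, in $\omega_1,\dots,\omega_n$, where $\omega^\alpha=\omega_{\alpha_1}\cdots\omega_{\alpha_k}$, $\alpha=(\alpha_1,\dots,\alpha_k)$, $k\ge0$, $|\alpha|:=k$; it has the topology of coefficient-wise convergence, and $\mathrm{Fr}_n^\circ(\mathcal E)$ has the induced topology. $\mathrm{Afr}_n(\mathcal E)\otimes\mathrm{Afr}_n(\mathcal E)$ is the algebra of formal series $\sum h_{\alpha,\beta}\,\omega^\alpha\otimes\omega^\beta$, $h_{\alpha,\beta}\in\mathcal E$, with factorwise multiplication, and $\delta:\mathrm{Afr}_n(\mathcal E)\to\mathrm{Afr}_n(\mathcal E)\otimes\mathrm{Afr}_n(\mathcal E)$ is the continuous unital $\mathcal E$-algebra homomorphism with $\delta(\omega_j)=\omega_j\otimes1+1\otimes\omega_j+\omega_j\otimes\omega_j$. For a series $x$ with zero constant term and $t\in\mathcal E$, $(1+x)^t:=\sum_{m\ge0}\frac{t(t-1)\cdots(t-m+1)}{m!}x^m$. Lyndon words: order words in the alphabet $a_1,\dots,a_n$ lexicographically ($\prec$, with $a_1\prec\dots\prec a_n$). A Lyndon word is a nonempty word that is $\prec$-less than each of its proper nonempty suffixes. The order $\lessdot$ on words: $\alpha\lessdot\beta$ if $|\alpha|<|\beta|$, or if $|\alpha|=|\beta|$ and $\alpha\prec\beta$.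 For elements $g_1,\dots,g_n$ of a group and a Lyndon word $L$, $\Xi_L(g_1,\dots,g_n)$ is defined recursively: $\Xi_{a_j}(g_1,\dots,g_n)=g_j$; if $|L|>1$, write $L=vw$ with $w$ the longest proper suffix of $L$ that is a Lyndon word (then $v$ is also Lyndon) and put $\Xi_L=\{\Xi_v,\Xi_w\}$, where $\{g,h\}:=g^{-1}h^{-1}gh$. The infinite product is understood as the coefficient-wise limit: modulo series with all terms of degree $>m$, the factors with $|L|>m$ are equal to $1$, so only finitely many factors matter. *)

(* Defs.v *)
From HB Require Import structures.
From mathcomp Require Import all_boot all_order all_algebra.
From mathcomp Require Import all_classical all_reals topology.
From mathcomp Require Import tvs zify ring.

Set Implicit Arguments.
Unset Strict Implicit.
Unset Printing Implicit Defensive.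
Set SsrOldRewriteGoalsOrder.

Import Order.TTheory GRing.Theory Num.Theory.

Local Open Scope classical_set_scope.
Local Open Scope ring_scope.

(* A commutative topological ring containing the rationals with the same unit.
   The unital morphism rat_in is automatically injective, and continuity of the
   opposite follows from that of the product. *)
HB.mixin Record hasContinuousMul_Rat E & Topological E & GRing.PzRing E := {
  mul_continuous : continuous (fun x : E * E => x.1 * x.2);
  rat_in : {rmorphism rat -> E}
}.

#[short(type="topRatRingType")]
HB.structure Definition TopRatRing :=
  {E of TopologicalZmodule E & GRing.ComNzRing E & hasContinuousMul_Rat E}.

Definition metrizable (R : realType) (T : topologicalType) : Prop :=
  exists d : T -> T -> R,
    [/\ forall x y, d x y = 0 <-> x = y,
        forall x y, d x y = d y x,
        forall x y z, d x z <= d x y + d y z &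
        forall x (A : set T),
          nbhs x A <-> exists2 e, 0 < e & [set y | d x y < e] `<=` A].

Definition Zbar (E : topRatRingType) : set E :=
  closure (range (intr : int -> E)).

(* Formal series in n noncommuting variables with coefficients in A: the word
   [:: i1; ...; ik] stands for the monomial w_i1 ... w_ik. *)
Definition series (n : nat) (A : Type) : Type := seq 'I_n -> A.

HB.instance Definition _ n (A : choiceType) :=
  Choice.copy (series n A) (prod_topology (fun _ : seq 'I_n => A)).
HB.instance Definition _ n (A : topologicalType) :=
  Topological.copy (series n A) (prod_topology (fun _ : seq 'I_n => A)).
HB.instance Definition _ n (A : zmodType) :=
  GRing.Zmodule.copy (series n A) (seq 'I_n -> A).

Section SeriesRing.
Variables (n : nat) (A : nzRingType).
Implicit Types (f g h : series n A) (w : seq 'I_n) (a : 'I_n).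

Definition series_const (c : A) : series n A :=
  fun w => if w is [::] then c else 0.

Definition series_var (j : 'I_n) : series n A :=
  fun w => if w == [:: j] then 1 else 0.

Definition series_mul f g : series n A :=
  fun w => \sum_(i < (size w).+1) f (take i w) * g (drop i w).

Definition series_shift a f : series n A := fun w => f (a :: w).

Lemma seriesD f g w : (f + g) w = f w + g w. Proof. by []. Qed.
Lemma seriesN f w : (- f) w = - f w. Proof. by []. Qed.
Lemma series0 w : (0 : series n A) w = 0. Proof. by []. Qed.

Lemma series_sum I (r : seq I) (P : pred I) (F : I -> series n A) w :
  (\sum_(i <- r | P i) F i) w = \sum_(i <- r | P i) F i w.
Proof. exact: (big_morph (fun f : series n A => f w)). Qed.

Lemma series_mul_nil f g : series_mul f g [::] = f [::] * g [::].
Proof. by rewrite /series_mul big_ord1. Qed.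

Lemma series_mul_cons f g a w : series_mul f g (a :: w) =
  f [::] * g (a :: w) + series_mul (series_shift a f) g w.
Proof. by rewrite /series_mul big_ord_recl. Qed.

Lemma series_mulDl : left_distributive series_mul +%R.
Proof.
move=> f g h; apply/funext => w; rewrite seriesD /series_mul -big_split /=.
by apply: eq_bigr => i _; rewrite seriesD mulrDl.
Qed.

Lemma series_mulDr : right_distributive series_mul +%R.
Proof.
move=> f g h; apply/funext => w; rewrite seriesD /series_mul -big_split /=.
by apply: eq_bigr => i _; rewrite seriesD mulrDr.
Qed.

Lemma series_constM c f w : series_mul (series_const c) f w = c * f w.
Proof.
case: w => [|a w]; first by rewrite series_mul_nil.
rewrite series_mul_cons /= /series_mul big1 ?addr0// => i _.
by rewrite /series_shift /= mul0r.
Qed.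

Lemma series_shiftM a f g : series_shift a (series_mul f g) =
  series_mul (series_const (f [::])) (series_shift a g) +
  series_mul (series_shift a f) g.
Proof.
apply/funext => w; rewrite seriesD series_constM.
by rewrite {1}/series_shift series_mul_cons.
Qed.

Lemma series_mulA : associative series_mul.
Proof.
move=> f g h; apply/funext => w.
elim: w f g h => [|a w IHw] f g h; first by rewrite !series_mul_nil mulrA.
rewrite !series_mul_cons -/(series_mul g h) !series_mul_nil series_shiftM.
rewrite series_mulDl seriesD -IHw -IHw series_constM mulrDr mulrA.
by rewrite addrA.
Qed.

Lemma series_mul1f : left_id (series_const 1) series_mul.
Proof. by move=> f; apply/funext => w; rewrite series_constM mul1r. Qed.

Lemma series_mulf1 : right_id (series_const 1) series_mul.
Proof.
move=> f; apply/funext => w.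
elim: w f => [|a w IHw] f; first by rewrite series_mul_nil mulr1.
by rewrite series_mul_cons IHw /= mulr0 add0r.
Qed.

Lemma series_oner_neq0 : series_const 1 != 0 :> series n A.
Proof.
apply/eqP => /(congr1 (fun f : series n A => f [::])) /= /eqP.
by rewrite oner_eq0.
Qed.

HB.instance Definition _ := GRing.Zmodule_isNzRing.Build (series n A)
  series_mulA series_mul1f series_mulf1 series_mulDl series_mulDr
  series_oner_neq0.

End SeriesRing.

Arguments series_const n {A} c.
Arguments series_var {n A} j.

Section SeriesOrder.
Variables (n : nat) (A : nzRingType).
Implicit Types (f g h : series n A) (w : seq 'I_n).

Lemma seriesM f g w :
  (f * g) w = \sum_(i < (size w).+1) f (take i w) * g (drop i w).
Proof. by []. Qed.

Lemma seriesM_nil f g : (f * g) [::] = f [::] * g [::].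
Proof. exact: series_mul_nil. Qed.

Lemma series_constMl c f w : (series_const n c * f) w = c * f w.
Proof. exact: series_constM. Qed.

Lemma series_constMr c f w : (f * series_const n c) w = f w * c.
Proof.
elim: w f => [|a w IHw] f; first exact: series_mul_nil.
by rewrite [LHS]series_mul_cons [X in _ + X]IHw mulr0 add0r.
Qed.

Lemma eq_seriesM f f' g g' w :
    (forall u, (size u <= size w)%N -> f u = f' u) ->
    (forall u, (size u <= size w)%N -> g u = g' u) ->
  (f * g) w = (f' * g') w.
Proof.
move=> ff' gg'; rewrite !seriesM; apply: eq_bigr => i _.
by rewrite ff' ?gg' ?size_drop ?leq_subr// size_take_min geq_minr.
Qed.

Definition order_ge (p : nat) f := forall w, (size w < p)%N -> f w = 0.

Lemma order_geM p q f g :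
  order_ge p f -> order_ge q g -> order_ge (p + q) (f * g).
Proof.
move=> fp gq w wpq; rewrite seriesM big1// => i _.
have [ip|pi] := ltnP i p.
  by rewrite fp ?mul0r// size_take_min (leq_ltn_trans (geq_minl _ _)).
rewrite (gq (drop i w)) ?mulr0// size_drop.
by rewrite ltn_subLR ?(leq_trans wpq) ?leq_add2r// -ltnS.
Qed.

Lemma order_geX f m : f [::] = 0 -> order_ge m (f ^+ m).
Proof.
move=> f0; have f1 : order_ge 1 f by case.
elim: m => [|m IHm]; first by [].
by rewrite exprS -add1n; exact: order_geM.
Qed.

(* The inverse of a series with constant term 1: g^-1 = \sum_m (1 - g)^m, where
   (1 - g)^m has no term of degree < m. *)
Definition series_inv g : series n A :=
  fun w => \sum_(m < (size w).+1) ((1 - g) ^+ m) w.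

Lemma series_inv_nil g : series_inv g [::] = 1.
Proof. by rewrite /series_inv big_ord1 expr0. Qed.

Lemma series_mulfV g : g [::] = 1 -> g * series_inv g = 1.
Proof.
move=> g1; set h := 1 - g; have h0 : h [::] = 0.
  by rewrite /h seriesD seriesN g1 subrr.
apply/funext => w.
transitivity ((g * \sum_(m < (size w).+1) h ^+ m) w).
  apply: eq_seriesM => // u uw; rewrite series_sum /series_inv -/h.
  rewrite -(subnKC uw) -addSn big_split_ord /= [X in _ + X]big1 ?addr0// => i _.
  by rewrite (order_geX h0)// addSn ltnS leq_addr.
have -> : g = - (h - 1) by rewrite /h opprB opprB addrC subrK.
rewrite mulNr -subrX1 opprB seriesD seriesN (order_geX h0)//.
by rewrite oppr0 addr0.
Qed.

Lemma series_mulVf g : g [::] = 1 -> series_inv g * g = 1.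
Proof.
move=> g1; set s := series_inv g.
have sV := series_mulfV (series_inv_nil g).
rewrite -[LHS]mulr1 -[X in _ * X]sV mulrA -[s * g * s]mulrA.
by rewrite series_mulfV// mulr1 sV.
Qed.

End SeriesOrder.

Lemma series_cvgP n (T : topologicalType) (F : set_system (series n T))
    (f : series n T) : Filter F ->
  F --> f <-> forall w, (fun g => g w) @ F --> f w.
Proof.
move=> FF; split=> [Ff w|Ff].
  by apply: cvg_trans (cvg_app _ Ff) _; exact: (@proj_continuous _ (fun=> T)).
apply/cvg_sup => w U /= [_ [[B oB <-] Bf] /filterS]; apply; apply: Ff.
exact: open_nbhs_nbhs.
Qed.

Section Coproduct.
Variables (n : nat) (E : topRatRingType).
Notation Afr := (series n E).
(* h : Afr2 is the series with coefficient h u v at w^u (x) w^v; the coefficient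
   at w^u is itself a series in the second tensor factor, and factorwise
   multiplication is multiplication of series with coefficients in Afr. *)
Notation Afr2 := (series n Afr).
Implicit Types (f g : Afr) (u v w : seq 'I_n).

Definition tensor f g : Afr2 := fun u v => f u * g v.

Definition delta_var (j : 'I_n) : Afr2 :=
  tensor (series_var j) 1 + tensor 1 (series_var j)
  + tensor (series_var j) (series_var j).

Definition delta_word w : Afr2 := \prod_(j <- w) delta_var j.

(* delta (\sum_w g_w w) = \sum_w g_w delta(w): since delta(w) only has terms of
   total degree at least |w|, the words w with |w| <= |u| + |v| are the only
   ones which contribute to the coefficient at u (x) v.  That delta is the
   continuous unital algebra morphism with the prescribed values at the
   variables is deltaD, deltaM, delta_const, delta_series_var and
   delta_continuous below. *)
Definition delta g : Afr2 := fun u v =>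
  \sum_(k < (size u + size v).+1) \sum_(w : k.-tuple 'I_n)
    g w * delta_word w u v.

Lemma tensorM f g f' g' : tensor f g * tensor f' g' = tensor (f * f') (g * g').
Proof.
apply/funext => u; apply/funext => v.
rewrite seriesM series_sum.
transitivity ((f * f') u * (g * g') v); last by [].
rewrite (seriesM f f') (seriesM g g') mulr_suml.
apply: eq_bigr => i _; rewrite [LHS]seriesM mulr_sumr.
by apply: eq_bigr => j _; rewrite mulrACA.
Qed.

Lemma tensor11 : tensor 1 1 = 1.
Proof.
apply/funext => u; apply/funext => v; rewrite /tensor.
by case: u => [|a u]; [exact: mul1r|exact: mul0r].
Qed.

Lemma Afr2M (x y : Afr2) u v : (x * y) u v =
  \sum_(i < (size u).+1) \sum_(j < (size v).+1)
    x (take i u) (take j v) * y (drop i u) (drop j v).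
Proof. by rewrite seriesM series_sum. Qed.

Let eqd N (x y : Afr2) :=
  forall u v, (size u + size v < N)%N -> x u v = y u v.

Lemma delta_var0 j : delta_var j [::] [::] = 0.
Proof.
rewrite /delta_var !seriesD /tensor /series_var /=.
by rewrite mul0r mulr0 mul0r !addr0.
Qed.

Let eqd_delta_varM N j x y :
  eqd N x y -> eqd N.+1 (delta_var j * x) (delta_var j * y).
Proof.
move=> xy u v uv; rewrite !Afr2M; apply: eq_bigr => i _; apply: eq_bigr => k _.
have [|ik] := posnP (i + k)%N.
  case: i k => [[|i] ?] [[|k] ?] //= _.
  by rewrite !take0 delta_var0 !mul0r.
congr (_ * _); apply: xy; rewrite !size_drop.
by case: i k ik => [i /= ?] [k /= ?] /=; lia.
Qed.

Lemma delta_word_eq0 w u v :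
  (size u + size v < size w)%N -> delta_word w u v = 0.
Proof.
elim: w u v => [//|j w IHw] u v /= uvw; rewrite /delta_word big_cons.
by rewrite (@eqd_delta_varM (size w) _ _ 0) ?mulr0.
Qed.

Lemma delta_trunc g N u v : (size u + size v < N)%N ->
  delta g u v =
  \sum_(k < N) \sum_(w : k.-tuple 'I_n) g w * delta_word w u v.
Proof.
move=> uvN; rewrite -(subnKC uvN) big_split_ord /= [X in _ = _ + X]big1 ?addr0//.
move=> i _; rewrite big1// => w _; rewrite delta_word_eq0 ?mulr0//.
by rewrite size_tuple addSn ltnS leq_addr.
Qed.

Definition Afr2_const (c : E) : Afr2 := series_const n (series_const n c).

Lemma Afr2_constM c (x : Afr2) u v : (Afr2_const c * x) u v = c * x u v.
Proof. by rewrite series_constMl series_constMl. Qed.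

Lemma Afr2_constMr c (x : Afr2) u v : (x * Afr2_const c) u v = x u v * c.
Proof. by rewrite series_constMr series_constMr. Qed.

Lemma Afr2_constC c (x : Afr2) : Afr2_const c * x = x * Afr2_const c.
Proof.
apply/funext => u; apply/funext => v.
by rewrite Afr2_constM Afr2_constMr mulrC.
Qed.

Lemma Afr2_sum I (r : seq I) (P : pred I) (F : I -> Afr2) u v :
  (\sum_(i <- r | P i) F i) u v = \sum_(i <- r | P i) F i u v.
Proof. by rewrite series_sum series_sum. Qed.

Let big_tuple_cons k k' (F : seq 'I_n -> E) : k' = k.+1 ->
  \sum_(w : k'.-tuple 'I_n) F w =
  \sum_(j < n) \sum_(w : k.-tuple 'I_n) F (j :: w).
Proof.
move->; rewrite pair_big /=.
rewrite (reindex (fun p : 'I_n * k.-tuple 'I_n => [tuple of p.1 :: p.2])) //=.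
exists (fun w : k.+1.-tuple 'I_n => (thead w, [tuple of behead w])).
  by move=> [j w] _ /=; congr (_, _); exact/val_inj.
by move=> w _; rewrite /= -tuple_eta.
Qed.

Lemma delta_rec g : delta g = Afr2_const (g [::]) +
  \sum_(j < n) delta_var j * delta (series_shift j g).
Proof.
apply/funext => u; apply/funext => v; rewrite !seriesD.
rewrite Afr2_sum (@delta_trunc _ (size u + size v).+2)//.
set N := (size u + size v).+1.
rewrite big_ord_recl; congr (_ + _).
  rewrite (eq_bigr (fun _ => g [::] * (1 : Afr2) u v)) => [|w _]; last first.
    by rewrite tuple0 /delta_word big_nil.
  by rewrite big_const card_tuple expn0 /= addr0 -Afr2_constM mulr1.
transitivity (\sum_(i < N) \sum_(j < n) \sum_(w : i.-tuple 'I_n)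
    g (j :: w) * delta_word (j :: w) u v).
  apply: eq_bigr => i _.
  by rewrite (big_tuple_cons (fun w => g w * delta_word w u v) (lift0 i)).
rewrite exchange_big; apply: eq_bigr => j _.
pose y : Afr2 := \sum_(i < N) \sum_(w : i.-tuple 'I_n)
  Afr2_const (g (j :: w)) * delta_word w.
rewrite (@eqd_delta_varM N _ _ y) => [|u' v' uv'|]; last by rewrite ltnS ltnW.
  rewrite mulr_sumr Afr2_sum; apply: eq_bigr => i _.
  rewrite mulr_sumr Afr2_sum; apply: eq_bigr => w _.
  by rewrite -Afr2_constM /delta_word big_cons !mulrA Afr2_constC.
rewrite (delta_trunc _ uv') /y Afr2_sum; apply: eq_bigr => i _.
by rewrite Afr2_sum; apply: eq_bigr => w _; rewrite Afr2_constM.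
Qed.

Lemma deltaD f g : delta (f + g) = delta f + delta g.
Proof.
apply/funext => u; apply/funext => v; rewrite !seriesD -big_split.
apply: eq_bigr => k _; rewrite -big_split; apply: eq_bigr => w _.
by rewrite seriesD mulrDl.
Qed.

Lemma delta0 : delta 0 = 0.
Proof. by apply: (addrI (delta 0)); rewrite -deltaD !addr0. Qed.

Lemma delta_const c : delta (series_const n c) = Afr2_const c.
Proof.
rewrite delta_rec big1 ?addr0// => j _.
by rewrite (_ : series_shift j _ = 0) ?delta0 ?mulr0.
Qed.

Lemma delta1 : delta 1 = 1.
Proof. exact: delta_const. Qed.

Lemma delta_series_var j : delta (series_var j) = delta_var j.
Proof.
rewrite delta_rec (_ : Afr2_const _ = 0) ?add0r; last first.
  by apply/funext => u; apply/funext => v; case: u => // ; case: v.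
rewrite (bigD1 j)//= big1 ?addr0 => [|k kj].
  rewrite (_ : series_shift j _ = 1) ?delta1 ?mulr1//.
  apply/funext => w; rewrite /series_shift /series_var eqseq_cons eqxx /=.
  by case: w.
rewrite (_ : series_shift k _ = 0) ?delta0 ?mulr0//.
by apply/funext => w; rewrite /series_shift /series_var eqseq_cons (negbTE kj).
Qed.

Lemma deltaM f g : delta (f * g) = delta f * delta g.
Proof.
suff H N f' g' : eqd N (delta (f' * g')) (delta f' * delta g').
  by apply/funext => u; apply/funext => v; exact: H (ltnSn _).
elim: N f' g' => {f g} [//|N IHN] f g u v uvN.
pose f0 := Afr2_const (f [::]).
have deltaZ c h : delta (series_const n c * h) = Afr2_const c * delta h.
  apply/funext => u'; apply/funext => v'; rewrite Afr2_constM /delta mulr_sumr.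
  apply: eq_bigr => k _; rewrite mulr_sumr; apply: eq_bigr => w _.
  by rewrite series_constMl mulrA.
transitivity ((Afr2_const (f [::] * g [::]) +
    (f0 * \sum_(j < n) delta_var j * delta (series_shift j g) +
     \sum_(j < n) delta_var j * delta (series_shift j f * g))) u v).
  rewrite delta_rec seriesM_nil mulr_sumr -big_split /=; congr ((_ + _) u v).
  apply: eq_bigr => j _; rewrite [series_shift j _]series_shiftM deltaD mulrDr.
  by rewrite deltaZ mulrA -Afr2_constC mulrA.
rewrite [delta f]delta_rec mulrDl -/f0 [in RHS]delta_rec mulrDr !seriesD.
rewrite -addrA; congr (_ + (_ + _)).
  by rewrite Afr2_constM /Afr2_const; case: u v {uvN} => [|? ?] [|? ?] //=;
    rewrite mulr0.
rewrite mulr_suml !Afr2_sum; apply: eq_bigr => j _; rewrite -mulrA.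
rewrite -delta_rec.
exact: (@eqd_delta_varM N j _ _ (IHN (series_shift j f) g) u v uvN).
Qed.

Lemma delta_continuous : continuous delta.
Proof.
move=> f; have FF : Filter (nbhs f) by exact: nbhs_filter.
apply/series_cvgP => u; apply/series_cvgP => v.
change ((fun g => delta g u v) @ f --> delta f u v); rewrite /delta.
apply: (cvg_big (@add_continuous E)) => k _.
apply: (cvg_big (@add_continuous E)) => w _.
apply: (@cvg_comp _ _ _ (fun g : Afr => (g w, delta_word w u v))
  (fun z : E * E => z.1 * z.2) _ (nbhs (f w, delta_word w u v))); last first.
  by have := @mul_continuous E (f w, delta_word w u v).
apply: cvg_pair; last exact: cvg_cst.
exact: (@proj_continuous _ (fun=> E : topologicalType)).
Qed.


End Coproduct.

Section GroupLike.
Variables (n : nat) (E : topRatRingType).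
Implicit Types f g : series n E.

Definition grouplike : set (series n E) :=
  [set g | g [::] = 1 /\ delta g = tensor g g].

Lemma grouplike1 : grouplike 1.
Proof. by split=> //; rewrite delta1 tensor11. Qed.

Lemma grouplikeM f g : grouplike f -> grouplike g -> grouplike (f * g).
Proof.
move=> [f1 df] [g1 dg]; split; first by rewrite seriesM_nil f1 g1 mulr1.
by rewrite deltaM df dg tensorM.
Qed.

Lemma grouplikeV g : grouplike g -> grouplike (series_inv g).
Proof.
move=> [g1 dg]; split; first exact: series_inv_nil.
rewrite -[LHS]mulr1 -[X in _ * X]tensor11 -(series_mulfV g1) -tensorM -dg.
by rewrite mulrA -deltaM series_mulVf// delta1 mul1r.
Qed.

Lemma grouplike_var j : grouplike (1 + series_var j).
Proof.
split; first by rewrite seriesD /series_var addr0.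
rewrite deltaD delta1 delta_series_var -tensor11 /delta_var.
apply/funext => u; apply/funext => v; rewrite !seriesD /tensor !seriesD.
by ring.
Qed.

(* The group Fr_n(E), with the topology induced by that of the series. *)
Definition Fr : Type := set_type grouplike.

HB.instance Definition _ := SubChoice.copy Fr (set_type grouplike).
HB.instance Definition _ := Topological.copy Fr (set_type grouplike).

Definition mkFr f (fG : grouplike f) : Fr := exist _ f (mem_set fG).

Lemma FrP (g : Fr) : grouplike (\val g).
Proof. exact: (set_mem (valP g)). Qed.

Let Fr1 : Fr := mkFr grouplike1.
Let FrM (g h : Fr) : Fr := mkFr (grouplikeM (FrP g) (FrP h)).
Let FrV (g : Fr) : Fr := mkFr (grouplikeV (FrP g)).

Let FrMA : associative FrM.
Proof. by move=> f g h; apply/val_inj; rewrite /= mulrA. Qed.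
Let FrM1g : left_id Fr1 FrM.
Proof. by move=> g; apply/val_inj; rewrite /= mul1r. Qed.
Let FrMg1 : right_id Fr1 FrM.
Proof. by move=> g; apply/val_inj; rewrite /= mulr1. Qed.
Let FrMVg : left_inverse Fr1 FrV FrM.
Proof.
by move=> g; apply/val_inj; apply: series_mulVf; have [] := FrP g.
Qed.
Let FrMgV : right_inverse Fr1 FrV FrM.
Proof.
by move=> g; apply/val_inj; apply: series_mulfV; have [] := FrP g.
Qed.

HB.instance Definition _ := isGroup.Build Fr FrMA FrM1g FrMg1 FrMVg FrMgV.

Lemma val_Fr1 : \val (1%g : Fr) = 1. Proof. by []. Qed.
Lemma val_FrM (g h : Fr) : \val (g * h)%g = \val g * \val h. Proof. by []. Qed.
Lemma val_FrV (g : Fr) : \val (g^-1)%g = series_inv (\val g). Proof. by []. Qed.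

Definition Fr_Zbar : set Fr := [set g | forall w, Zbar (\val g w)].

Definition Fr_gen (j : 'I_n) : Fr := mkFr (grouplike_var j).

End GroupLike.

Definition is_subgroup (G : groupType) (H : set G) : Prop :=
  [/\ H 1%g, forall x y, H x -> H y -> H (x * y)%g &
      forall x, H x -> H (x^-1)%g].

Definition free_subgroup n (E : topRatRingType) : set (Fr n E) :=
  smallest (@is_subgroup (Fr n E)) (range (@Fr_gen n E)).

Arguments Fr_Zbar n E : clear implicits.
Arguments free_subgroup n E : clear implicits.

Section Lyndon.
Variable n : nat.
Implicit Types u v w L : seq 'I_n.

(* Dictionary order: a proper prefix of a word is smaller than the word. *)
Definition word_lt u v : bool := (u < v :> seqlexi 'I_n)%O.

Definition lyndon L : bool :=
  (L != [::]) && all (fun i => word_lt L (drop i L)) (iota 1 (size L).-1).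

Definition word_llt u v : bool :=
  (size u < size v)%N || (size u == size v) && word_lt u v.

(* The length of v in the factorisation L = vw with w the longest proper suffix
   of L which is a Lyndon word. *)
Definition lyndon_cut L : nat :=
  (find (fun i => lyndon (drop i L)) (iota 1 (size L).-1)).+1.

Fixpoint Xi_rec (G : groupType) (g : 'I_n -> G) (k : nat) L : G :=
  match k, L with
  | _, [:: j] => g j
  | k'.+1, _ :: _ :: _ =>
      let v := take (lyndon_cut L) L in
      let w := drop (lyndon_cut L) L in
      [~ Xi_rec g k' v, Xi_rec g k' w]%g
  | _, _ => 1%g
  end.

(* Xi_L(g_1, ..., g_n); see Xi1 and XiE for the recursive definition. *)
Definition Xi (G : groupType) (g : 'I_n -> G) L : G := Xi_rec g (size L) L.

Lemma lyndonP L : reflect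
  (L <> [::] /\ forall v w, L = v ++ w -> v <> [::] -> w <> [::] -> word_lt L w)
  (lyndon L).
Proof.
apply: (iffP andP) => -[/eqP L0 H]; split=> //; last apply/allP => i.
  move=> v w Lvw v0 w0; move/allP: H => /(_ (size v)).
  have <- : drop (size v) L = w by rewrite Lvw drop_size_cat.
  apply; rewrite mem_iota Lvw size_cat.
  by case: v v0 {Lvw} => // a v _; case: w w0 => // b w _ /=; lia.
rewrite mem_iota => iL; apply: (H (take i L)); first by rewrite cat_take_drop.
  by move/(congr1 size); rewrite size_take_min /=; lia.
by move/(congr1 size); rewrite size_drop /=; lia.
Qed.

Lemma lyndon1 j : lyndon [:: j]. Proof. by []. Qed.

Lemma lyndon_cutP L : (1 < size L)%N ->
  [/\ (0 < lyndon_cut L < size L)%N, lyndon (drop (lyndon_cut L) L) &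
      forall i, (0 < i < lyndon_cut L)%N -> ~~ lyndon (drop i L)].
Proof.
move=> L1; rewrite /lyndon_cut; set a := fun i => _; set s := iota _ _.
have as_ : has a s.
  apply/hasP; exists (size L).-1; first by rewrite mem_iota; lia.
  rewrite /a; case/lastP: L L1 {a s} => // L j _.
  by rewrite size_rcons /= -cats1 drop_size_cat// lyndon1.
have fs : (find a s < (size L).-1)%N by rewrite -(size_iota 1 (size L).-1) -has_find.
split.
- by lia.
- by have := nth_find 0%N as_; rewrite nth_iota// add1n.
- move=> i /andP[i0]; rewrite ltnS => ifs.
  have ifs' : (i.-1 < find a s)%N by lia.
  have := before_find 0%N ifs'; rewrite nth_iota ?add1n ?prednK//; last by lia.
  exact: negbT.
Qed.

Lemma Xi_recS (G : groupType) (g : 'I_n -> G) k a b L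
    (c := lyndon_cut (a :: b :: L)) :
  Xi_rec g k.+1 (a :: b :: L) =
  [~ Xi_rec g k (take c (a :: b :: L)), Xi_rec g k (drop c (a :: b :: L))]%g.
Proof. by []. Qed.

Lemma Xi_rec_size (G : groupType) (g : 'I_n -> G) k L :
  (size L <= k)%N -> Xi_rec g k L = Xi g L.
Proof.
rewrite /Xi; elim/ltn_ind: k L => k IHk [|a [|b L]].
- by case: k {IHk}.
- by case: k {IHk}.
case: k IHk => // k IHk Lk.
have [/andP[c0 cL] _ _] := @lyndon_cutP (a :: b :: L) isT.
rewrite [size (a :: b :: L) in RHS]/= !Xi_recS.
move: (lyndon_cut _) c0 cL => c c0 cL; rewrite [size _]/= in cL.
have s1 : (size (take c (a :: b :: L)) <= size (b :: L))%N.
  by rewrite size_take_min /=; lia.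
have s2 : (size (drop c (a :: b :: L)) <= size (b :: L))%N.
  by rewrite size_drop /=; lia.
have [e|ne] := eqVneq k (size (b :: L)); first by rewrite e.
have sk : (size (b :: L) < k)%N by move: Lk ne => /=; lia.
rewrite !(IHk (size L).+1)//=; try by rewrite /= in sk; rewrite ltnS ltnW.
by rewrite !(IHk k)//; [exact: leq_trans s2 (ltnW sk)|exact: leq_trans s1 (ltnW sk)].
Qed.

Lemma Xi1 (G : groupType) (g : 'I_n -> G) j : Xi g [:: j] = g j.
Proof. by []. Qed.

Lemma XiE (G : groupType) (g : 'I_n -> G) L : (1 < size L)%N ->
  Xi g L =
  [~ Xi g (take (lyndon_cut L) L), Xi g (drop (lyndon_cut L) L)]%g.
Proof.
case: L => [//|a [//|b L]] L1.
have [/andP[c0 cL] _ _] := lyndon_cutP L1.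
rewrite {1}/Xi [size _]/= Xi_recS; move: (lyndon_cut _) c0 cL => c c0 cL; rewrite [size _]/= in cL.
by rewrite !Xi_rec_size ?size_take_min ?size_drop //=; lia.
Qed.

Definition words_of_size k : seq (seq 'I_n) :=
  [seq tval x | x <- enum {: k.-tuple 'I_n}].

(* The Lyndon words of length at most m, increasing for word_llt. *)
Definition lyndon_words m : seq (seq 'I_n) :=
  sort (fun u v => (u == v) || word_llt u v)
       [seq L <- flatten [seq words_of_size k | k <- iota 0 m.+1] | lyndon L].

Lemma mem_lyndon_words m L :
  (L \in lyndon_words m) = lyndon L && (size L <= m)%N.
Proof.
rewrite mem_sort mem_filter; congr (_ && _); apply/flatten_mapP/idP.
  by move=> [k]; rewrite mem_iota => km /mapP[w _ ->]; rewrite size_tuple; lia.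
move=> Lm; exists (size L); first by rewrite mem_iota.
by apply/mapP; exists (in_tuple L); rewrite ?mem_enum.
Qed.

Let le u v := (u == v) || word_llt u v.

Let le_trans_ : transitive le.
Proof.
move=> v u w /predU1P[->//|uv] /predU1P[<-|vw]; first by rewrite /le uv orbT.
rewrite /le; apply/orP; right; move: uv vw; rewrite /word_llt.
move=> /orP[uv|/andP[/eqP uv uv']] /orP[vw|/andP[/eqP vw vw']].
- by rewrite (ltn_trans uv vw).
- by rewrite -vw uv.
- by rewrite uv vw.
- by rewrite uv vw eqxx /word_lt (lt_trans uv' vw') orbT.
Qed.

Let le_total : total le.
Proof.
move=> u v; rewrite /le /word_llt /word_lt.
have [uv|uv|uv] := ltngtP (size u) (size v); rewrite ?orbT //=.
have [_|_|e] := @ltgtP _ (seqlexi 'I_n) u v; rewrite ?eqxx ?orbT//.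
Qed.

Let le_anti : antisymmetric le.
Proof.
move=> u v /andP[/predU1P[//|uv] /predU1P[->//|vu]]; move: uv vu.
rewrite /word_llt /word_lt.
have [uv|uv|uv] //= := ltngtP (size u) (size v).
by have [||->] := @ltgtP _ (seqlexi 'I_n) u v.
Qed.

Lemma lyndon_words_uniq m : uniq (lyndon_words m).
Proof.
rewrite sort_uniq filter_uniq//; elim: m => [|m IHm].
  by rewrite /= cats0 map_inj_uniq ?enum_uniq//; exact: val_inj.
rewrite -[m.+2]addn1 iotaD map_cat flatten_cat cat_uniq IHm.
set s := flatten [seq _ | k <- iota 0 m.+1]; rewrite /= cats0.
rewrite map_inj_uniq ?enum_uniq ?andbT; last exact: val_inj.
apply/hasPn => _ /mapP[w _ ->]; apply/flatten_mapP => -[k].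
rewrite mem_iota => km /mapP[v _ wv]; have := size_tuple w.
by rewrite wv size_tuple; lia.
Qed.

Lemma lyndon_words_sorted m : sorted word_llt (lyndon_words m).
Proof.
have := sort_sorted le_total
  [seq L <- flatten [seq words_of_size k | k <- iota 0 m.+1] | lyndon L].
rewrite -/(lyndon_words m); have := lyndon_words_uniq m.
case: (lyndon_words m) => // L s /=; elim: s L => //= K s IHs L.
rewrite inE negb_or => /andP[/andP[LK Ls] /andP[Ks us]] /andP[/predU1P[e|LK'] p].
  by rewrite e eqxx in LK.
by rewrite LK' IHs// Ks.
Qed.

Lemma lyndon_wordsS m : exists2 s,
  lyndon_words m.+1 = lyndon_words m ++ s & all (fun L => size L == m.+1) s.
Proof.
pose s := sort le [seq L <- words_of_size m.+1 | lyndon L].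
have ss : all (fun L => size L == m.+1) s.
  apply/allP => L; rewrite mem_sort mem_filter => /andP[_ /mapP[w _ ->]].
  by rewrite size_tuple.
exists s => //; apply: (sorted_eq le_trans_ le_anti).
- exact: sort_sorted.
- rewrite sorted_pairwise// pairwise_cat -!sorted_pairwise// !sort_sorted// !andbT.
  apply/allrelP => L K; rewrite mem_lyndon_words => /andP[_ Lm].
  by move=> /(allP ss)/eqP Km; rewrite /le /word_llt Km ltnS Lm orbT.
- rewrite perm_sort -[m.+2]addn1 iotaD map_cat flatten_cat filter_cat /= cats0.
  by apply: perm_cat; rewrite perm_sym perm_sort.
Qed.

End Lyndon.

Section Products.
Variables (n : nat) (E : topRatRingType).
Implicit Types (g : series n E) (t : E).

(* The binomial coefficient t (t - 1) ... (t - m + 1) / m!. *)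
Definition binomE t (m : nat) : E :=
  rat_in (m`!%:R^-1) * \prod_(i < m) (t - i%:R).

(* g^t for g = 1 + x with x of zero constant term: the coefficient at w of
   \sum_m binomE t m * x^m, where x^m has no term of degree < m. *)
Definition series_pow g t : series n E :=
  fun w => \sum_(m < (size w).+1) binomE t m * ((g - 1) ^+ m) w.

Lemma series_cvg_near (F : nat -> series n E) g :
  (forall w, exists N, forall m, (N <= m)%N -> F m w = g w) -> F @ \oo --> g.
Proof.
move=> Fg; apply/series_cvgP => w; have [N FN] := Fg w.
by apply: cvg_near_cst; exists N => // m /= Nm; rewrite FN.
Qed.

Lemma cvg_series_pow g t : g [::] = 1 ->
  (fun N => \sum_(m < N) series_const n (binomE t m) * (g - 1) ^+ m) @ \oo
    --> series_pow g t.
Proof.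
move=> g1; apply: series_cvg_near => w; exists (size w).+1 => N wN.
have g0 : (g - 1) [::] = 0 by rewrite seriesD seriesN g1 subrr.
rewrite series_sum -(subnKC wN) big_split_ord /= [X in _ + X]big1 ?addr0.
  by apply: eq_bigr => m _; rewrite series_constMl.
by move=> m _; rewrite series_constMl (order_geX g0) ?mulr0// addSn ltnS leq_addr.
Qed.

Lemma series_pow_order g t p :
  order_ge p (g - 1) -> order_ge p (series_pow g t - 1).
Proof.
move=> gp w wp; rewrite seriesD seriesN /series_pow big_ord_recl expr0 /binomE.
rewrite big_ord0 fact0 invr1 rmorph1 !mul1r big1 ?addr0 ?subrr// => m _.
rewrite lift0 exprS [X in _ * X](_ : _ = 0) ?mulr0//.
by apply: (@order_geM _ _ p 0) => //; rewrite addn0.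
Qed.

Lemma Xi_order L : (0 < size L)%N ->
  order_ge (size L) (\val (Xi (@Fr_gen n E) L) - 1).
Proof.
have [k] := ubnP (size L); elim: k L => // k IHk [//|a [|b L]] Lk L0.
  rewrite Xi1 /= addrC addKr => w; rewrite ltnS leqn0 size_eq0 => /eqP ->.
  by [].
set M := a :: b :: L; have [/andP[c0 cM] _ _] := @lyndon_cutP _ M isT.
rewrite XiE//; set c := lyndon_cut M in c0 cM *.
set x := Xi _ (take c M); set y := Xi _ (drop c M).
have sx : size (take c M) = c by rewrite size_take cM.
have sy : size (drop c M) = (size M - c)%N by rewrite size_drop.
have xo : order_ge c (\val x - 1).
  by rewrite -sx; apply: IHk; rewrite sx// (leq_trans cM).
have yo : order_ge (size M - c) (\val y - 1).
  by rewrite -sy; apply: IHk; rewrite sy; move: Lk cM; rewrite /M /=; lia.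
have -> : \val [~ x, y]%g - 1 = series_inv (\val x) * (series_inv (\val y) *
    ((\val x - 1) * (\val y - 1) - (\val y - 1) * (\val x - 1))).
  have x1 : (\val x) [::] = 1 by have [] := FrP x.
  have y1 : (\val y) [::] = 1 by have [] := FrP y.
  have -> : (\val x - 1) * (\val y - 1) - (\val y - 1) * (\val x - 1) =
      \val x * \val y - \val y * \val x.
    rewrite !mulrBl !mulrBr !mul1r !mulr1; apply/funext => w.
    by rewrite !(seriesD, seriesN); ring.
  rewrite !mulrBr; congr (_ - _).
  by rewrite [series_inv (\val y) * _]mulrA series_mulVf// mul1r series_mulVf.
rewrite -(subnKC (ltnW cM)) -[X in order_ge X]add0n; apply: order_geM => //.
rewrite -[X in order_ge X]add0n; apply: order_geM => // w wM.
rewrite seriesD seriesN (order_geM xo yo)// (order_geM yo xo) ?subrr//.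
by rewrite addnC.
Qed.

(* The product of the factors with |L| <= m. *)
Definition lyndon_prod (t : seq 'I_n -> E) (m : nat) : series n E :=
  \prod_(L <- lyndon_words n m) series_pow (\val (Xi (@Fr_gen n E) L)) (t L).

Lemma lyndon_prod_cvg (t : seq 'I_n -> E) :
  exists p : series n E, lyndon_prod t @ \oo --> p.
Proof.
have stepE m w : (size w <= m)%N -> lyndon_prod t m.+1 w = lyndon_prod t m w.
  move=> wm; rewrite /lyndon_prod; have [s -> ss] := lyndon_wordsS n m.
  rewrite big_cat /=; set P := \prod_(L <- lyndon_words n m) _.
  rewrite -[P in RHS]mulr1; apply: eq_seriesM => // u uw.
  have {uw wm} um : (size u < m.+1)%N by rewrite ltnS (leq_trans uw).
  suff H : order_ge m.+1 (\prod_(L <- s) series_pow (\val (Xi (@Fr_gen n E) L)) (t L) - 1).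
    by apply/eqP; rewrite -subr_eq0 -seriesN -seriesD H.
  elim: s ss => [_|L s IHs /= /andP[/eqP Lm ss]].
    by rewrite big_nil subrr.
  rewrite big_cons; set q := series_pow _ _; set r := \prod_(_ <- _) _.
  have -> : q * r - 1 = (q - 1) * r + (r - 1) by rewrite mulrBl mul1r addrA subrK.
  move=> v vm; rewrite seriesD (IHs ss)// addr0.
  rewrite -[m.+1]addn0 in vm; apply: order_geM vm => //.
  by rewrite -Lm; apply: series_pow_order; apply: Xi_order; rewrite Lm.
exists (fun w => lyndon_prod t (size w) w); apply: series_cvg_near => w.
exists (size w); elim=> [|m IHm]; first by rewrite leqn0 => /eqP ->.
rewrite leq_eqVlt => /predU1P[<-//|]; rewrite ltnS => wm.
by rewrite stepE// IHm.
Qed.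

End Products.

(* Main.v *)
Require Import Defs.
From mathcomp Require Import all_boot all_order all_algebra.
From mathcomp Require Import all_classical all_reals topology.
From mathcomp Require Import tvs zify ring.

Set Implicit Arguments.
Unset Strict Implicit.
Unset Printing Implicit Defensive.

Import Order.TTheory GRing.Theory Num.Theory.

Local Open Scope classical_set_scope.
Local Open Scope ring_scope.

(* Elements of F_n have integer coefficients, and for x in F_n the series x^t
   depends continuously on t and lies in F_n for integral t; hence the products
   of the Xi_L^(t_L) with t_L in the closure of Z all lie in the closure of F_n,
   which consists of group-like series with coefficients in the closure of Z.

   Conversely, let g be such a series and suppose that after dividing out the
   factors with |L| < m there remains h = 1 + (terms of degree m) + ...  In
   degree m, Xi_L - 1 has coefficient 1 at L and 0 at all smaller words, so that
   dividing successively by Xi_L^(t_L), with t_L the current coefficient at L,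
   kills all coefficients at Lyndon words of length m.  What remains vanishes in
   degree m: being group-like, its part of degree m is orthogonal to all
   shuffles, and a word which is not Lyndon is the largest word of the shuffle
   product of its first Lyndon factor with the product of the others. *)

(** * Lyndon words and shuffles *)

Section Words.
Variable n : nat.
Implicit Types (u v w x y z l L : seq 'I_n) (F G : seq (seq 'I_n)).

Lemma word_lt_cons a b u v :
  word_lt (a :: u) (b :: v) = (a < b)%O || (a == b) && word_lt u v.
Proof. by rewrite /word_lt ltxi_cons; case: (ltgtP a b). Qed.

Lemma word_lt0 u : word_lt u [::] = false.
Proof. exact: ltxis0. Qed.

Lemma word_0lt u : word_lt [::] u = (u != [::]).
Proof. exact: ltxi0s. Qed.

Lemma word_ltxx u : word_lt u u = false.
Proof. exact: ltxx. Qed.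

Lemma word_lt_trans : transitive (@word_lt n).
Proof. by move=> v u w; exact: lt_trans. Qed.

Lemma word_le_lt_trans v u w : ~~ word_lt v u -> word_lt v w -> word_lt u w.
Proof. by rewrite -leNgt; exact: le_lt_trans. Qed.

Lemma word_lt_le_trans v u w : word_lt u v -> ~~ word_lt w v -> word_lt u w.
Proof. by rewrite -leNgt; exact: lt_le_trans. Qed.

Lemma word_ltNgt u v : word_lt u v -> ~~ word_lt v u.
Proof. by move=> uv; rewrite -leNgt ltW. Qed.

Lemma word_eqNlt u v : ~~ word_lt u v -> ~~ word_lt v u -> u = v.
Proof.
by rewrite -!leNgt => vu uv; apply: (@le_anti _ (seqlexi 'I_n)); rewrite uv vu.
Qed.

Lemma word_lt_cat2l w u v : word_lt (w ++ u) (w ++ v) = word_lt u v.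
Proof. by elim: w => //= a w IHw; rewrite word_lt_cons ltxx eqxx IHw. Qed.

Lemma word_lt_catr u v : word_lt u (u ++ v) = (v != [::]).
Proof. by rewrite -{1}[u]cats0 word_lt_cat2l word_0lt. Qed.

Lemma word_lt_cat u v x y :
  word_lt u v -> ~~ prefix u v -> word_lt (u ++ x) (v ++ y).
Proof.
elim: u v => [|a u IHu] [|b v]; rewrite ?prefix0s ?word_lt0//=.
rewrite !word_lt_cons; by have [//|//|_] := ltgtP a b; exact: IHu.
Qed.

(** If [u] were a prefix of [v], the sizes would force [u = v]. So the two differ at a common
    position, which decides. *)
Lemma word_lt_cat_size u v x y :
  word_lt u v -> (size v <= size u)%N -> word_lt (u ++ x) (v ++ y).
Proof.
move=> uv vu; apply: word_lt_cat => //; apply/negP => /prefixP[z vE].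
move: vu uv; rewrite vE size_cat -[X in (_ <= X)%N]addn0 leq_add2l leqn0.
by move=> /nilP ->; rewrite cats0 word_ltxx.
Qed.

Lemma lyndon_neq0 l : lyndon l -> l != [::].
Proof. by case/andP. Qed.

Lemma lyndon_lt_suffix v w :
  lyndon (v ++ w) -> v != [::] -> w != [::] -> word_lt (v ++ w) w.
Proof.
by move=> /lyndonP[_ vwl] /eqP v0 /eqP w0; apply: vwl.
Qed.

(** First [u ++ v] is below [v]: if [v = u ++ y], cancel [u] and use that [v] is below its suffix
    [y]. A proper suffix starting inside [u] is then handled by [u] being Lyndon, any other one by
    [v] being Lyndon. *)
Lemma lyndon_cat u v : lyndon u -> lyndon v -> word_lt u v -> lyndon (u ++ v).
Proof.
move=> ul vl uv; have u0 := lyndon_neq0 ul; have v0 := lyndon_neq0 vl.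
have uvv : word_lt (u ++ v) v.
  have [/prefixP[y vE]|upv] := boolP (prefix u v); last first.
    by rewrite -[X in word_lt _ X]cats0 word_lt_cat.
  have y0 : y != [::] by apply: contraL uv => /eqP y0; rewrite vE y0 cats0 word_ltxx.
  by rewrite [X in word_lt _ X]vE word_lt_cat2l vE lyndon_lt_suffix -?vE.
apply/lyndonP; split; first by case: (u) u0.
move=> x w uvE /eqP x0 /eqP w0.
have xuw : take (size x) (u ++ v) = x by rewrite uvE take_size_cat.
have wuw : drop (size x) (u ++ v) = w by rewrite uvE drop_size_cat.
rewrite take_cat in xuw; rewrite drop_cat in wuw.
have xpos : (0 < size x)%N by rewrite lt0n size_eq0.
case: ltnP xuw wuw => xu xE wE.
  have uE : u = x ++ drop (size x) u by rewrite -{1}xE cat_take_drop.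
  rewrite -wE; apply: word_lt_cat_size; last by rewrite size_drop leq_subr.
  rewrite [X in word_lt X _]uE; apply: lyndon_lt_suffix => //.
    by rewrite -uE.
  by rewrite -size_eq0 size_drop subn_eq0 -ltnNge.
set i := (size x - size u)%N in xE wE.
have [i0|i0] := posnP i; first by rewrite -wE i0 drop0.
apply: (word_lt_trans uvv); rewrite -[X in word_lt X _](cat_take_drop i) -wE.
apply: lyndon_lt_suffix; rewrite ?cat_take_drop ?wE//.
by rewrite -size_eq0 size_take; case: ltnP => //; rewrite ?lt0n ?size_eq0 -?lt0n.
Qed.

(** * Nonincreasing factorisations into Lyndon words *)

Definition word_ge u v : bool := ~~ word_lt u v.

Lemma word_ge_trans : transitive word_ge.
Proof. by move=> v u w; rewrite /word_ge -!leNgt => uv vw; exact: le_trans uv. Qed.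

Lemma word_ge_anti : antisymmetric word_ge.
Proof. by move=> u v /andP[]; exact: word_eqNlt. Qed.

Lemma word_ge_total : total word_ge.
Proof.
by move=> u v; rewrite /word_ge; case: (boolP (word_lt u v)) => // /word_ltNgt.
Qed.

(* F is the Lyndon factorisation of the word flatten F. *)
Definition lyndon_fact F : bool := all (@lyndon n) F && sorted word_ge F.

(** As long as [l] is smaller than the next factor, it absorbs that factor by [lyndon_cat]; then it
    can be put in front. *)
Lemma lyndon_fact_insert l F : lyndon l -> lyndon_fact F ->
  exists2 G, lyndon_fact G & flatten G = l ++ flatten F.
Proof.
elim: F l => [|k F IHF] l ll; first by exists [:: l]; rewrite /lyndon_fact /= ?ll.
move=> /andP[/= /andP[kl Fl] Fs]; have [lk|kl'] := boolP (word_lt l k).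
  have [||G GF GE] := IHF (l ++ k); first exact: lyndon_cat.
    by rewrite /lyndon_fact Fl (path_sorted Fs).
  by exists G => //; rewrite GE catA.
by exists (l :: k :: F) => //; rewrite /lyndon_fact /= ll kl Fl /word_ge kl'.
Qed.

Lemma lyndon_fact_exists w : exists2 F, lyndon_fact F & flatten F = w.
Proof.
elim: w => [|a w [F FF Fw]]; first by exists [::].
have [G GF GE] := lyndon_fact_insert (lyndon1 a) FF.
by exists G => //; rewrite GE Fw.
Qed.

(** The last factor is a suffix of [flatten F], hence larger than [l], and the other factors are at
    least as large as the last. *)
Lemma lyndon_fact_gt l F : lyndon_fact F ->
    (forall x y, flatten F = x ++ y -> y != [::] -> word_lt l y) ->
  all (word_lt l) F.
Proof.
elim: F => //= k F IHF /andP[/= /andP[kl Fl] Fs] lF.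
have {}IHF : all (word_lt l) F.
  apply: IHF; first by rewrite /lyndon_fact Fl (path_sorted Fs).
  by move=> x y FE; apply: (lF (k ++ x)); rewrite FE catA.
rewrite IHF andbT; case: F Fs IHF {Fl} lF => [_ _|h F /= /andP[kh _] /andP[lh _] _].
  by rewrite /= cats0 => lF; apply: (lF [::]) => //; exact: lyndon_neq0.
exact: word_lt_le_trans lh _.
Qed.

Lemma lyndon_behead_fact a w F : lyndon (a :: w) -> lyndon_fact F ->
  flatten F = w -> all (word_lt (a :: w)) F.
Proof.
move=> awl FF FE; apply: lyndon_fact_gt => // x y; rewrite FE => wE y0.
by have := @lyndon_lt_suffix (a :: x) y; rewrite /= -wE; apply.
Qed.

(** If [l = p ++ r], cancel [p] and use that [l] is below its suffix [r]. Otherwise [p] is below [l]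
    without being a prefix of it, so what follows does not matter. *)
Lemma lyndon_prefix_lt l p q x y : lyndon l -> p != [::] ->
  word_lt (p ++ q) l -> word_lt (p ++ l ++ x) (l ++ y).
Proof.
move=> ll p0 pql; have [/prefixP[r lE]|pl] := boolP (prefix p l).
  have r0 : r != [::].
    by apply: contraTneq pql => r0; rewrite lE r0 word_lt_cat2l word_lt0.
  rewrite {2}lE -!catA word_lt_cat2l word_lt_cat_size//.
    by rewrite {1}lE lyndon_lt_suffix -?lE.
  by rewrite lE size_cat leq_addl.
apply: word_lt_cat => //; apply: word_le_lt_trans pql.
by rewrite -leNgt; case: q => [|b q]; rewrite ?cats0 // ltW// [(_ < _)%O]word_lt_catr.
Qed.

(** * Merging Lyndon factorisations and the largest shuffle *)

Lemma merge_cons (k l : seq 'I_n) F G :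
  merge word_ge (k :: F) (l :: G) =
  if word_ge k l then k :: merge word_ge F (l :: G)
  else l :: merge word_ge (k :: F) G.
Proof. by []. Qed.

(** The word [l] comes out at the latest when [F1] is used up; [H1] is the part of [F1] that
    precedes it. *)
Lemma merge_split_lt F1 F2 l G : all ((@word_lt n)^~ l) F2 ->
  exists H1 H2 K : seq (seq 'I_n), F1 = H1 ++ H2 /\
    merge word_ge (F1 ++ F2) (l :: G) = H1 ++ l :: K.
Proof.
move=> F2l; elim: F1 => [|k F1 [H1 [H2 [K [F1E mE]]]]].
  case: F2 F2l => [_|k F2 /= /andP[kl _]]; first by exists [::], [::], G.
  by rewrite {1}/word_ge kl; exists [::], [::]; eexists.
rewrite cat_cons merge_cons; case: ifPn => kl.
  exists (k :: H1), H2, K; split; first by rewrite F1E.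
  by rewrite mE.
by exists [::], (k :: F1); eexists.
Qed.

Lemma merge_cat_ge F1 F2 l G : all (word_ge^~ l) F1 ->
  merge word_ge (F1 ++ F2) (l :: G) = F1 ++ merge word_ge F2 (l :: G).
Proof. by elim: F1 => //= k F1 IHF /andP[-> /IHF ->]. Qed.

(* Compares the merged word before and after its first letter a is taken from the
   factor a :: w.  The factors of w are all larger than a :: w, hence are merged
   before F2; and if some l > a :: w of G comes after a prefix p of a :: w, then
   p ++ l is still smaller than l, by lyndon_prefix_lt. *)
Lemma lyndon_merge_step a w F1 F2 G :
    lyndon (a :: w) -> lyndon_fact F1 -> flatten F1 = w ->
    lyndon_fact ((a :: w) :: F2) -> lyndon_fact G ->
  word_ge (flatten (merge word_ge ((a :: w) :: F2) G))
          (a :: flatten (merge word_ge (F1 ++ F2) G)).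
Proof.
move=> awl F1F F1E F2F GF; have awF1 := lyndon_behead_fact awl F1F F1E.
case: G GF => [_|l G /andP[/= /andP[ll _] _]].
  have m0 (s : seq (seq 'I_n)) : merge word_ge s [::] = s by case: s.
  by rewrite !m0 flatten_cat F1E /word_ge word_ltxx.
case: ifPn => awl'.
  rewrite merge_cat_ge; last first.
    apply/allP => x /(allP awF1) awx; rewrite /word_ge -leNgt ltW//.
    by apply: le_lt_trans awx; rewrite leNgt.
  by rewrite /= flatten_cat F1E /word_ge word_ltxx.
rewrite negbK in awl'.
have F2l : all ((@word_lt n)^~ l) F2.
  case/andP: F2F => _ /(order_path_min word_ge_trans)/allP F2aw.
  by apply/allP => x /F2aw /word_le_lt_trans; apply.
have [H1 [H2 [K [F1H ->]]]] := merge_split_lt F1 G F2l.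
rewrite flatten_cat /= /word_ge word_ltNgt//.
rewrite -cat_cons; apply: (@lyndon_prefix_lt l _ (flatten H2)) => //.
by rewrite cat_cons -flatten_cat -F1H F1E.
Qed.

(** The factors of [w] exceed [a :: w], which is at least as large as each factor in [F2]. *)
Lemma lyndon_fact_behead a w F1 F2 : lyndon_fact ((a :: w) :: F2) ->
  lyndon_fact F1 -> flatten F1 = w -> lyndon_fact (F1 ++ F2).
Proof.
move=> /andP[/= /andP[awl F2l] F2s] F1F F1E.
have awF1 := lyndon_behead_fact awl F1F F1E.
case/andP: F1F => F1l F1s; rewrite /lyndon_fact all_cat F1l F2l /=.
rewrite sorted_pairwise ?pairwise_cat -?sorted_pairwise ?F1s; try exact: word_ge_trans.
rewrite (path_sorted F2s) !andbT; apply/allrelP => x y /(allP awF1) awx.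
move=> /(allP (order_path_min word_ge_trans F2s)) awy.
by rewrite /word_ge word_ltNgt//; exact: word_le_lt_trans awx.
Qed.

(** The multiplicity of [w] in the shuffle product of [u] and [v]. *)
Fixpoint shuffle_count w u v : nat :=
  if w is j :: w' then
    (if u is a :: u' then (a == j) * shuffle_count w' u' v else 0) +
    (if v is b :: v' then (b == j) * shuffle_count w' u v' else 0)
  else (u == [::]) && (v == [::]).

Lemma shuffle_count_cat u v : (0 < shuffle_count (u ++ v) u v)%N.
Proof.
elim: u => [|a u IHu] /=; last by rewrite eqxx mul1n addn_gt0 IHu.
by elim: v => //= b v IHv; rewrite eqxx mul1n add0n.
Qed.

(** Induction on [w]: its first letter is taken from the first Lyndon factor of one side;
    [lyndon_merge_step] compares the merges before and after, and the induction hypothesis bounds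
    the rest. *)
Lemma lyndon_shuffle_le F G w : lyndon_fact F -> lyndon_fact G ->
  (0 < shuffle_count w (flatten F) (flatten G))%N ->
  word_ge (flatten (merge word_ge F G)) w.
Proof.
have mergeC H K : lyndon_fact H -> lyndon_fact K ->
    merge word_ge H K = merge word_ge K H.
  move=> /andP[_ Hs] /andP[_ Ks]; apply: (sorted_eq word_ge_trans word_ge_anti).
  - by rewrite merge_sorted// => x y; exact: word_ge_total.
  - by rewrite merge_sorted// => x y; exact: word_ge_total.
  - by rewrite perm_merge perm_sym perm_merge perm_catC.
elim: w F G => [|j w IHw] F G FF GF; first by rewrite /word_ge word_lt0.
(* The disjunction lets [H] be either side of the shuffle, the merge being symmetric by [mergeC]. *)
have step H K u : lyndon_fact H -> lyndon_fact K -> flatten H = j :: u ->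
    (0 < shuffle_count w u (flatten K))%N \/ (0 < shuffle_count w (flatten K) u)%N ->
    word_ge (flatten (merge word_ge H K)) (j :: w).
  case: H => [//|[|a v] H] HF KF; first by case/andP: (HF).
  move=> /= [aj uE] sh; rewrite -{j}aj in uE *.
  have [H1 H1F H1E] := lyndon_fact_exists v.
  have vl : lyndon (a :: v) by case/andP: HF => /andP[].
  have H1H := lyndon_fact_behead HF H1F H1E.
  apply: word_ge_trans (lyndon_merge_step vl H1F H1E HF KF) _.
  rewrite /word_ge word_lt_cons ltxx eqxx /=.
  have H1u : flatten (H1 ++ H) = u by rewrite flatten_cat H1E.
  by case: sh => sh; [|rewrite mergeC//]; apply: IHw; rewrite // H1u.
rewrite /= addn_gt0 => /orP[].
  case FE: (flatten F) => [//|a u]; rewrite muln_gt0 lt0b => /andP[/eqP aj sh].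
  by apply: (step _ _ u) => //; [rewrite FE aj|left].
case GE: (flatten G) => [//|a u]; rewrite muln_gt0 lt0b => /andP[/eqP aj sh].
by rewrite mergeC//; apply: (step _ _ u) => //; [rewrite GE aj|right].
Qed.

(** A word that is not Lyndon has at least two factors. Merging the first with the others gives back
    the factorisation of [w], so [lyndon_shuffle_le] bounds all shuffles by [w]. *)
Lemma nlyndon_shuffle w : w != [::] -> ~~ lyndon w -> exists u v,
  [/\ w = u ++ v, u != [::], v != [::] &
      forall z, (0 < shuffle_count z u v)%N -> ~~ word_lt w z].
Proof.
move=> w0 wl; have [[|l [|k F]] FF FE] := lyndon_fact_exists w.
- by rewrite -FE in w0.
- by case/andP: FF wl => /andP[ll _] _; rewrite -FE /= cats0 ll.
move: (FF) => /andP[/= /and3P[ll kl Fl] /andP[lk Fs]].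
exists l, (flatten (k :: F)); split; [by []|exact: lyndon_neq0|..].
  by rewrite /=; case: (k) (lyndon_neq0 kl).
move=> z; have := @lyndon_shuffle_le [:: l] (k :: F) z.
rewrite merge_cons lk FE -[flatten [:: l]]/(l ++ [::]) cats0; apply.
  by rewrite /lyndon_fact /= ll.
by rewrite /lyndon_fact /= kl Fl.
Qed.

(** If [v] had several Lyndon factors, the last one [l] would be at most the first, which is a
    prefix of [L], hence at most [L], and so below [w]. Then [l ++ w] would be a Lyndon proper
    suffix longer than [w]. *)
Lemma lyndon_cut_factors L : lyndon L -> (1 < size L)%N ->
  let v := take (lyndon_cut L) L in let w := drop (lyndon_cut L) L in
  [/\ lyndon v, lyndon w, word_lt L w & word_lt v w].
Proof.
move=> Ll L1 v w; have [/andP[c0 cL] wl cmin] := lyndon_cutP L1.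
have LE : L = v ++ w by rewrite cat_take_drop.
have sv : size v = lyndon_cut L by rewrite size_take cL.
have v0 : v != [::] by rewrite -size_eq0 sv -lt0n.
have Lw : word_lt L w by rewrite {1}LE lyndon_lt_suffix -?LE// lyndon_neq0.
have vleL x y : v = x ++ y -> ~~ word_lt L x.
  move=> vE; rewrite LE vE -catA -leNgt; case: (y ++ w) => [|b z].
    by rewrite cats0.
  by rewrite ltW// [(_ < _)%O]word_lt_catr.
have vw : word_lt v w.
  by apply: word_le_lt_trans Lw; apply: (vleL _ [::]); rewrite cats0.
split=> //; have [F FF FE] := lyndon_fact_exists v; rewrite -FE.
case: F FF FE => [_ FE|k F FF FE]; first by rewrite -FE in v0.
case/lastP: F FF FE => [|F l]; first by move=> /andP[/= /andP[kl _] _]; rewrite cats0.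
rewrite /lyndon_fact /= all_rcons => /andP[/and3P[kl ll Fl]].
move=> /(order_path_min word_ge_trans)/allP/(_ l).
rewrite mem_rcons in_cons eqxx => /(_ isT) kl' FE.
have k0 := lyndon_neq0 kl; have l0 := lyndon_neq0 ll.
rewrite flatten_rcons catA in FE.
have lw : word_lt l w.
  apply: word_le_lt_trans Lw; apply: word_ge_trans kl'; apply: vleL.
  by rewrite -FE -catA.
have lwl := lyndon_cat ll wl lw; exfalso.
set p := k ++ flatten F in FE.
have := cmin (size p); rewrite -sv -FE size_cat.
rewrite -{2}[size p]addn0 ltn_add2l !lt0n !size_eq0 l0 andbT.
have -> : p != [::] by rewrite /p; case: (k) k0.
by move=> /(_ isT); rewrite LE -FE -catA drop_size_cat// lwl.
Qed.

End Words.

(** * Leading terms of group-like series *)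

Section SeriesLead.
Variables (n : nat) (A : nzRingType).
Implicit Types (f g : series n A) (w : seq 'I_n).

Lemma series1E w : (1 : series n A) w = (w == [::])%:R.
Proof. by case: w. Qed.

Lemma order_geD p f g : order_ge p f -> order_ge p g -> order_ge p (f + g).
Proof. by move=> fp gp w wp; rewrite seriesD fp// gp// addr0. Qed.

Lemma order_geN p f : order_ge p f -> order_ge p (- f).
Proof. by move=> fp w wp; rewrite seriesN fp// oppr0. Qed.

Lemma order_geM1 m f g :
  order_ge m (f - 1) -> order_ge m (g - 1) -> order_ge m (f * g - 1).
Proof.
move=> fm gm; have -> : f * g - 1 = (f - 1) * g + (g - 1).
  by rewrite mulrBl mul1r addrA subrK.
by apply: order_geD => //; rewrite -[m]addn0; apply: order_geM.
Qed.

Lemma order_geV1 m f :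
  f [::] = 1 -> order_ge m (f - 1) -> order_ge m (series_inv f - 1).
Proof.
move=> f1 fm; have -> : series_inv f - 1 = - (series_inv f * (f - 1)).
  by rewrite mulrBr series_mulVf// mulr1 opprB.
by apply: order_geN; rewrite -[m]add0n; apply: order_geM.
Qed.

Lemma order_geM_lead p q f g w :
    order_ge p f -> order_ge q g -> size w = (p + q)%N ->
  (f * g) w = f (take p w) * g (drop p w).
Proof.
move=> fp gq wpq; have pw : (p < (size w).+1)%N by rewrite wpq ltnS leq_addr.
rewrite seriesM (bigD1 (Ordinal pw))//= big1 ?addr0// => i.
rewrite -val_eqE /= neq_ltn => /orP[ip|pi].
  by rewrite fp ?mul0r// size_take_min (leq_ltn_trans (geq_minl _ _)).
by rewrite (gq (drop i w)) ?mulr0// size_drop; have := ltn_ord i; lia.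
Qed.

Lemma order_ge_mul_unital f g m w : f [::] = 1 -> order_ge m g -> size w = m ->
  (f * g) w = g w.
Proof.
by move=> f1 gm wm; rewrite (@order_geM_lead 0 m)// take0 drop0 f1 mul1r.
Qed.

(** The cross term [(f - 1) * (g - 1)] starts only in degree [2 m], which exceeds [m]. *)
Lemma order_geM1_lead m f g w : (0 < m)%N ->
    order_ge m (f - 1) -> order_ge m (g - 1) -> size w = m ->
  (f * g) w = f w + g w.
Proof.
move=> m0 fm gm wm; have -> : f * g = (f - 1) * (g - 1) + (f + g - 1).
  rewrite mulrBl mul1r mulrBr mulr1 -[f + g - 1]addrA.
  by rewrite -[f * g - f - _]addrA -opprD subrK.
rewrite !seriesD seriesN (order_geM fm gm); last by rewrite wm -addn1 leq_add.
by rewrite series1E -size_eq0 wm -[m]prednK//= subr0 add0r.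
Qed.

Lemma series_varM j f w : (series_var j * f) w =
  if w is a :: w' then if a == j then f w' else 0 else 0.
Proof.
case: w => [|a w]; first by rewrite seriesM_nil mul0r.
rewrite [LHS]series_mul_cons {1}/series_var mul0r add0r.
have -> : series_shift a (series_var j) =
    series_const n (if a == j then 1 : A else 0).
  apply/funext => -[|b u]; rewrite /series_shift /series_var eqseq_cons.
    by rewrite andbT.
  by rewrite andbF.
by rewrite [LHS]series_constMl; case: ifP => _; rewrite ?mul1r ?mul0r.
Qed.

End SeriesLead.

(** * The coproduct in lowest degree and leading terms of commutators *)

Section Coproduct.
Variables (n : nat) (E : topRatRingType).
Implicit Types (f g : series n E) (u v w L : seq 'I_n).

(** The summands follow those of [delta_var]: the letter [j] goes to the left factor, to the right
    one, or to both. *)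
Lemma delta_word_cons j w u v : @delta_word n E (j :: w) u v =
  (if u is a :: u' then if a == j then delta_word E w u' v else 0 else 0) +
  (if v is b :: v' then if b == j then delta_word E w u v' else 0 else 0) +
  (if u is a :: u' then if a == j then
     (if v is b :: v' then if b == j then delta_word E w u' v' else 0 else 0)
   else 0 else 0).
Proof.
(* In series with series coefficients, the left copy of the variable is a variable and the right
   copy a constant. *)
set V : series n (series n E) := series_var j.
set C := series_const n (series_var j : series n E).
have VE : tensor (series_var j) 1 = V.
  apply/funext => x; apply/funext => y; rewrite /tensor /V /series_var.
  by case: ifP; rewrite ?mul1r ?mul0r.
have CE : tensor 1 (series_var j) = C.
  apply/funext => x; apply/funext => y; rewrite /tensor /C series1E.
  by case: x => [|? ?]; rewrite ?mul1r ?mul0r.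
have VCE : tensor (series_var j) (series_var j : series n E) = V * C.
  by rewrite -VE -CE tensorM mulr1 mul1r.
rewrite /delta_word big_cons -/(delta_word E w) /delta_var VE CE VCE.
rewrite !mulrDl -mulrA !seriesD !series_varM !series_constMl series_varM.
congr (_ + _ + _); first by case: u => // a u; case: ifP.
by case: u => // a u; case: ifP => // _; rewrite series_constMl series_varM.
Qed.

(** A letter sent to both factors leaves too few letters to match, so only the shuffle terms survive
    in this degree. *)
Lemma delta_word_shuffle w u v : size w = (size u + size v)%N ->
  delta_word E w u v = (shuffle_count w u v)%:R.
Proof.
elim: w u v => [|j w IHw] u v.
  move=> /esym/eqP; rewrite addn_eq0 => /andP[/nilP -> /nilP ->].
  by rewrite /delta_word big_nil.
rewrite delta_word_cons /= natrD => uv; rewrite -[RHS]addr0.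
congr (_ + _ + _).
- case: u uv => // a u [uv]; case: eqP => _; rewrite ?mul0n// mul1n.
  by rewrite IHw// uv.
- case: v uv => // b v; rewrite addnS => -[uv]; case: eqP => _; rewrite ?mul0n//.
  by rewrite mul1n IHw// uv.
- case: u v uv => [//|a u] [|b v]; first by case: eqP.
  rewrite /= addnS => -[uv]; case: eqP => // _; case: eqP => // _.
  by rewrite delta_word_eq0// uv.
Qed.

(* The coefficients of degree m of f = 1 + (terms of degree m) + ... are
   orthogonal to all shuffles: in lowest degree f is primitive for the coproduct
   dual to the shuffle product. *)
Lemma grouplike_shuffle f m u v : grouplike f -> order_ge m (f - 1) ->
    u != [::] -> v != [::] -> (size u + size v)%N = m ->
  \sum_(w : m.-tuple 'I_n) f w * (shuffle_count w u v)%:R = 0.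
Proof.
move=> [f1 df] fm u0 v0 uvm.
have f0 w : w != [::] -> (size w < m)%N -> f w = 0.
  move=> w0 /fm /eqP; rewrite seriesD seriesN series1E (negbTE w0).
  by rewrite subr0 => /eqP.
have um : (size u < m)%N by rewrite -uvm -[X in (X < _)%N]addn0 ltn_add2l lt0n size_eq0.
have := congr1 (fun h : series n (series n E) => h u v) df.
rewrite [RHS]/tensor (f0 u)// mul0r (@delta_trunc _ _ _ m.+1) ?uvm//.
rewrite big_ord_recr /= big1 ?add0r => [|k _].
  move=> dfuv; rewrite -[RHS]dfuv; apply: eq_bigr => w _.
  by rewrite delta_word_shuffle// size_tuple uvm.
rewrite big1// => w _; have [w0|w0] := eqVneq (tval w) [::].
  by rewrite w0 /delta_word big_nil (series1E _ u) (negbTE u0) mulr0.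
by rewrite f0 ?mul0r// size_tuple.
Qed.

(** Although [E] may have zero divisors, positive integers are units, as images of rationals. *)
Lemma topRat_mulrn_eq0 (x : E) k : (0 < k)%N -> x * k%:R = 0 -> x = 0.
Proof.
move=> k0 xk; rewrite -[x]mulr1 -(rmorph1 (@rat_in E)).
rewrite -(@mulfV _ k%:R) ?pnatr_eq0 -?lt0n// rmorphM rmorph_nat mulrA xk.
exact: mul0r.
Qed.

(** A smallest word [x] of length [m] with nonzero coefficient is not Lyndon, hence is the largest
    shuffle of some [u] and [v]. In the relation of [grouplike_shuffle] all other shuffles are
    smaller and have coefficient 0, so a positive multiple of [f x] vanishes. *)
Lemma grouplike_lyndon_eq0 f m : grouplike f -> order_ge m (f - 1) ->
    (forall L, lyndon L -> size L = m -> f L = 0) ->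
  order_ge m.+1 (f - 1).
Proof.
move=> fG fm fL w; rewrite ltnS leq_eqVlt => /predU1P[wm|]; last exact: fm.
rewrite seriesD seriesN series1E; have [->|w0] := eqVneq w [::].
  by case: fG => -> _; rewrite subrr.
rewrite subr0; apply/eqP; apply/negPn/negP => fw0.
have fw0' : f (tcast wm (in_tuple w)) != 0 by rewrite val_tcast.
case: (@arg_minP _ _ _ _ (fun z => f (tval z) != 0)
  (fun z : m.-tuple 'I_n => tval z : seqlexi 'I_n) fw0') => x fx0 xmin.
have x0 : tval x != [::] by rewrite -size_eq0 size_tuple -wm size_eq0.
have [|u [v [xE u0 v0 uvx]]] := nlyndon_shuffle x0.
  by apply: contraNN fx0 => xL; rewrite fL// size_tuple.
have /(grouplike_shuffle fG fm u0 v0) : (size u + size v)%N = m.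
  by rewrite -size_cat -xE size_tuple.
rewrite (bigD1 x)//= big1 ?addr0 => [|z zx].
  have xk : (0 < shuffle_count x u v)%N by rewrite xE shuffle_count_cat.
  by move=> /(topRat_mulrn_eq0 xk)/eqP; rewrite (negbTE fx0).
have [->|sz] := posnP (shuffle_count z u v); first by rewrite mulr0.
have [->|/xmin xz] := eqVneq (f z) 0; first by rewrite mul0r.
by case/eqP: zx; apply/val_inj/word_eqNlt; rewrite ?uvx// -leNgt.
Qed.

(** Turns the group commutator into an additive one, up to factors of constant term 1, which do not
    affect the lowest degree. *)
Lemma val_commgB1 (x y : Fr n E) :
  \val [~ x, y]%g - 1 = series_inv (\val x) * (series_inv (\val y) *
    ((\val x - 1) * (\val y - 1) - (\val y - 1) * (\val x - 1))).
Proof.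
have x1 : (\val x) [::] = 1 by have [] := FrP x.
have y1 : (\val y) [::] = 1 by have [] := FrP y.
have -> : (\val x - 1) * (\val y - 1) - (\val y - 1) * (\val x - 1) =
    \val x * \val y - \val y * \val x.
  by apply/funext => z; rewrite !mulrBl !mulrBr !(seriesD, seriesN) !mul1r !mulr1; ring.
rewrite !mulrBr; congr (_ - _).
by rewrite [series_inv (\val y) * _]mulrA series_mulVf// mul1r series_mulVf.
Qed.

(** Induction along [L = v ++ u]: in degree [size L] only the bracket [X * Y - Y * X] counts, and
    each product is evaluated at a single cut of [w]. *)
Lemma Xi_lead L w : lyndon L -> size w = size L -> ~~ word_lt L w ->
  (\val (Xi (@Fr_gen n E) L) - 1) w = (w == L)%:R.
Proof.
have [k] := ubnP (size L); elim: k L w => // k IHk L w Lk Ll wL Lw.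
have [L1|] := ltnP 1 (size L); last first.
  case: L Ll {Lk wL Lw} => [//|a [|//]] _ _.
  by rewrite Xi1 /= addrAC subrr add0r /series_var; case: ifP.
have [/andP[c0 cL] _ _] := lyndon_cutP L1.
have [vl ul Lu vu] := lyndon_cut_factors Ll L1.
rewrite XiE//; set v := take _ L in vl vu *; set u := drop _ L in ul Lu vu *.
have LE : L = v ++ u by rewrite cat_take_drop.
have sL : size L = (size v + size u)%N by rewrite LE size_cat.
have u0 : (0 < size u)%N by rewrite lt0n size_eq0 lyndon_neq0.
have v0 : (0 < size v)%N by rewrite lt0n size_eq0 lyndon_neq0.
have vk : (size v < k)%N by lia.
have uk : (size u < k)%N by lia.
have Xo := @Xi_order n E _ v0; have Yo := @Xi_order n E _ u0.
have XL z := IHk v z vk vl; have YL z := IHk u z uk ul.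
set x := Xi _ v in Xo XL *; set y := Xi _ u in Yo YL *.
rewrite val_commgB1.
set X := \val x - 1 in Xo XL *; set Y := \val y - 1 in Yo YL *.
have XYo : order_ge (size L) (X * Y) by rewrite sL; exact: order_geM.
have YXo : order_ge (size L) (Y * X) by rewrite sL addnC; exact: order_geM.
have Qo : order_ge (size L) (X * Y - Y * X).
  by apply: order_geD => //; exact: order_geN.
rewrite (order_ge_mul_unital _ _ wL) ?series_inv_nil//; last first.
  by rewrite -[size L]add0n; exact: order_geM.
rewrite (order_ge_mul_unital _ _ wL) ?series_inv_nil// seriesD seriesN.
rewrite (order_geM_lead Xo Yo) -?sL// (order_geM_lead Yo Xo);
  last by rewrite wL sL addnC.
(* The prefix of [w] of length [size u] is not above [L], hence strictly below [u], where [Y]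
   vanishes. *)
rewrite [X in _ - X](_ : _ = 0) ?subr0; last first.
  have zw : size (take (size u) w) = size u by rewrite size_takel// wL sL leq_addl.
  have Luw : ~~ word_lt L (take (size u) w).
    apply: contraNN Lw => Lz; rewrite -[L]cats0.
    rewrite -[w in word_lt _ w](cat_take_drop (size u)).
    by apply: word_lt_cat_size; rewrite // zw sL leq_addl.
  rewrite YL//; last by apply: contraNN Luw; exact: word_lt_trans.
  by case: eqP => [zu|]; rewrite ?mul0r//; rewrite zu Lu in Luw.
have zw : size (take (size v) w) = size v by rewrite size_takel// wL sL leq_addr.
(* The prefix is at most [v], so [X] contributes only when it equals [v]; the remaining suffix is
   then at most [u]. *)
have vw : ~~ word_lt v (take (size v) w).
  apply: contraNN Lw => Lz; rewrite LE -[w in word_lt _ w](cat_take_drop (size v)).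
  by apply: word_lt_cat_size; rewrite // zw.
rewrite -[w in RHS](cat_take_drop (size v)) LE eqseq_cat// XL//.
case: eqP => [zv|]; rewrite ?mul0r//= mul1r YL//.
  by rewrite size_drop wL sL addKn.
by apply: contraNN Lw => uz; rewrite LE -[w](cat_take_drop (size v)) zv word_lt_cat2l.
Qed.

End Coproduct.

(** * Closures and powers *)

Section Closures.

Lemma metrizable_hausdorff (R : realType) (T : topologicalType) :
  metrizable R T -> hausdorff_space T.
Proof.
move=> [d [d0 dC dT dN]] x y xy; apply/(d0 _ _).1/eqP; rewrite eq_le.
have dxy0 : 0 <= d x y.
  have := dT x y x.
  rewrite [d y x]dC (iffRL (d0 x x))// -mulr2n.
  by rewrite pmulrn_lge0.
rewrite dxy0 andbT leNgt; apply/negP => d_gt0.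
have dz z : nbhs z [set u | d z u < d x y / 2].
  by apply/dN; exists (d x y / 2) => //; apply: divr_gt0.
have [z [/= xz yz]] := xy _ _ (dz x) (dz y).
rewrite dC in yz.
by have := le_lt_trans (dT x z y) (ltrD xz yz); rewrite -splitr ltxx.
Qed.

Lemma closure_image (T U : topologicalType) (F : T -> U) (A : set T) t :
  continuous F -> closure A t -> closure (F @` A) (F t).
Proof.
move=> Fc At B /Fc FB; have [a [Aa Ba]] := At _ FB.
by exists (F a); split=> //; exists a.
Qed.

Lemma closure_op2 (T : topologicalType) (op : T -> T -> T) (A : set T) x y :
    continuous (fun p : T * T => op p.1 p.2) ->
    (forall a b, A a -> A b -> A (op a b)) ->
  closure A x -> closure A y -> closure A (op x y).
Proof.
move=> opc opA Ax Ay B /(opc (x, y))[[P Q]] [/= Px Qy] PQB.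
have [a [Aa Pa]] := Ax _ Px; have [b [Ab Qb]] := Ay _ Qy.
by exists (op a b); split; [exact: opA|exact: (PQB (a, b))].
Qed.

Lemma closure_eq (T U : topologicalType) (F G : T -> U) (A : set T) t :
    hausdorff_space U -> continuous F -> continuous G ->
    (forall a, A a -> F a = G a) ->
  closure A t -> F t = G t.
Proof.
move=> hU Fc Gc FG At; apply: hU => B C /Fc FB /Gc GC.
have [a [Aa [/= Ba Ca]]] := At _ (@filterI _ (nbhs t) _ (F @^-1` B) (G @^-1` C) FB GC).
by exists (F a); split => //; rewrite FG.
Qed.

Lemma closure_cvg (T : topologicalType) (A : set T) (F : nat -> T) x :
  (forall m, A (F m)) -> F @ \oo --> x -> closure A x.
Proof.
move=> AF Fx B /Fx [N _ NB]; exists (F N); split => //; exact: NB (leqnn N).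
Qed.

Variable (E : topRatRingType).
Implicit Types (s t : E).

Lemma Zbar_int (k : int) : Zbar (k%:~R : E).
Proof. by apply: subset_closure; exists k. Qed.

Lemma Zbar0 : Zbar (0 : E). Proof. by have := @Zbar_int 0; rewrite rmorph0. Qed.

Lemma Zbar1 : Zbar (1 : E). Proof. by have := @Zbar_int 1; rewrite rmorph1. Qed.

Lemma ZbarD s t : Zbar s -> Zbar t -> Zbar (s + t).
Proof.
apply: (@closure_op2 _ +%R); first exact: add_continuous.
by move=> _ _ [k _ <-] [l _ <-]; exists (k + l); rewrite ?rmorphD.
Qed.

Lemma ZbarM s t : Zbar s -> Zbar t -> Zbar (s * t).
Proof.
apply: (@closure_op2 _ *%R); first exact: mul_continuous.
by move=> _ _ [k _ <-] [l _ <-]; exists (k * l); rewrite ?rmorphM.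
Qed.

Lemma ZbarN t : Zbar t -> Zbar (- t).
Proof. by rewrite -mulN1r; apply: ZbarM; have := @Zbar_int (-1); rewrite rmorphN1. Qed.

Lemma Zbar_sum I (r : seq I) (P : pred I) (F : I -> E) :
  (forall i, P i -> Zbar (F i)) -> Zbar (\sum_(i <- r | P i) F i).
Proof. by move=> FZ; apply: big_ind FZ; [exact: Zbar0|exact: ZbarD]. Qed.

Variable n : nat.
Implicit Types (f g : series n E) (w : seq 'I_n).

Definition Zbar_series f : Prop := forall w, Zbar (f w).

Lemma Zbar_series1 : Zbar_series 1.
Proof. by move=> w; rewrite series1E; case: eqP => _; [exact: Zbar1|exact: Zbar0]. Qed.

Lemma Zbar_seriesB f g : Zbar_series f -> Zbar_series g -> Zbar_series (f - g).
Proof.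
by move=> fZ gZ w; rewrite seriesD seriesN; apply: ZbarD => //; exact: ZbarN.
Qed.

Lemma Zbar_seriesM f g : Zbar_series f -> Zbar_series g -> Zbar_series (f * g).
Proof. by move=> fZ gZ w; rewrite seriesM; apply: Zbar_sum => i _; exact: ZbarM. Qed.

Lemma Zbar_seriesV f : Zbar_series f -> Zbar_series (series_inv f).
Proof.
move=> fZ w; apply: Zbar_sum => i _.
suff : Zbar_series ((1 - f) ^+ i) by apply.
elim: (val i) => [|k IHk]; first exact: Zbar_series1.
rewrite exprS; apply: Zbar_seriesM => //.
by apply: Zbar_seriesB => //; exact: Zbar_series1.
Qed.

Lemma series_coef_continuous (T : topologicalType) w :
  continuous (fun f : series n T => f w).
Proof. exact: (@proj_continuous _ (fun=> T)). Qed.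

Lemma series_mul_continuous :
  continuous (fun p : series n E * series n E => p.1 * p.2).
Proof.
move=> p; have FF : Filter (nbhs p) by exact: nbhs_filter.
apply/series_cvgP => w.
change ((fun p : series n E * series n E => (p.1 * p.2) w) @ p --> (p.1 * p.2) w).
rewrite seriesM; apply: (cvg_big (@add_continuous E)) => i _.
apply: (@cvg_comp _ _ _ (fun p : series n E * series n E =>
    (p.1 (take i w), p.2 (drop i w))) (fun z : E * E => z.1 * z.2) _
  (nbhs (p.1 (take i w), p.2 (drop i w)))); last first.
  by have := @mul_continuous E (p.1 (take i w), p.2 (drop i w)).
apply: cvg_pair.
  apply: (@cvg_comp _ _ _ fst (fun f : series n E => f (take i w)) _ (nbhs p.1)).
    exact: cvg_fst.
  exact: series_coef_continuous.
apply: (@cvg_comp _ _ _ snd (fun f : series n E => f (drop i w)) _ (nbhs p.2)).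
  exact: cvg_snd.
exact: series_coef_continuous.
Qed.

Lemma binomE_continuous m : continuous (fun t => binomE t m).
Proof.
move=> t; apply: (@cvg_comp _ _ _
  (fun t => (rat_in m`!%:R^-1, \prod_(i < m) (t - i%:R))) (fun z : E * E => z.1 * z.2)
  _ (nbhs (rat_in m`!%:R^-1, \prod_(i < m) (t - i%:R)))); last first.
  by have := @mul_continuous E (rat_in m`!%:R^-1, \prod_(i < m) (t - i%:R)).
apply: cvg_pair; first exact: cvg_cst.
apply: (cvg_big (@mul_continuous E)) => i _.
apply: (@cvg_comp _ _ _ (fun t => (t, - i%:R)) (fun z : E * E => z.1 + z.2)
  _ (nbhs (t, - i%:R))); last first.
  by have := @add_continuous E (t, - i%:R).
by apply: cvg_pair; [exact: cvg_id|exact: cvg_cst].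
Qed.

Lemma series_pow_continuous g : continuous (series_pow g).
Proof.
move=> t; have FF : Filter (nbhs t) by exact: nbhs_filter.
apply/series_cvgP => w.
change ((fun t => series_pow g t w) @ t --> series_pow g t w).
rewrite /series_pow; apply: (cvg_big (@add_continuous E)) => m _.
apply: (@cvg_comp _ _ _ (fun t => (binomE t m, ((g - 1) ^+ m) w))
  (fun z : E * E => z.1 * z.2) _ (nbhs (binomE t m, ((g - 1) ^+ m) w))); last first.
  by have := @mul_continuous E (binomE t m, ((g - 1) ^+ m) w).
by apply: cvg_pair; [exact: binomE_continuous|exact: cvg_cst].
Qed.

Lemma delta_coef_continuous u v : continuous (fun f : series n E => delta f u v).
Proof.
move=> f; apply: (@cvg_comp _ _ _ (fun f => delta f u)
    (fun h : series n E => h v) _ (nbhs (delta f u))); last first.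
  exact: series_coef_continuous.
apply: (@cvg_comp _ _ _ (@delta n E) (fun h : series n (series n E) => h u)
    _ (nbhs (delta f))); last exact: series_coef_continuous.
exact: delta_continuous.
Qed.

(** The conditions are equations between continuous functions into a Hausdorff space, the second one
    coefficient by coefficient. *)
Lemma grouplike_closed : hausdorff_space E -> closed (@grouplike n E).
Proof.
move=> hE f fG; split.
  apply: (@closure_eq _ _ (fun f => f [::]) (fun=> 1) _ _ hE _ _ _ fG).
  - exact: series_coef_continuous.
  - exact: cst_continuous.
  - by move=> g [].
apply/funext => u; apply/funext => v.
apply: (@closure_eq _ _ (fun f => delta f u v) (fun f => f u * f v) _ _ hE
  (@delta_coef_continuous u v) _ _ fG).
  move=> g; have FF : Filter (nbhs g) by exact: nbhs_filter.
  apply: (@cvg_comp _ _ _ (fun g : series n E => (g u, g v))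
    (fun z : E * E => z.1 * z.2) _ (nbhs (g u, g v))); last first.
    by have := @mul_continuous E (g u, g v).
  by apply: cvg_pair; exact: series_coef_continuous.
by move=> g [_ ->].
Qed.

(** Open sets of [Fr] are preimages of open sets of series, so closures may be computed among all
    series. *)
Lemma closure_val (A : set (Fr n E)) (g : Fr n E) :
  closure A g <-> closure [set \val h | h in A] (\val g).
Proof.
split; first by apply: closure_image; exact: initial_continuous.
move=> Ag B [_ [[O oO <-] Og] OB].
have [_ [[h Ah <-] Oh]] := Ag O (open_nbhs_nbhs (conj oO Og)).
by exists h; split => //; exact: OB.
Qed.

End Closures.

(** * Binomial powers with exponents in [E] *)

Section Powers.
Variables (n : nat) (E : topRatRingType).
Implicit Types (g : series n E) (t : E) (w : seq 'I_n).

Lemma binomE0 t : binomE t 0 = 1.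
Proof. by rewrite /binomE fact0 invr1 rmorph1 big_ord0 mulr1. Qed.

Lemma binomE1 t : binomE t 1 = t.
Proof. by rewrite /binomE invr1 rmorph1 big_ord1 subr0 mul1r. Qed.

Lemma binomE_pascal t m : binomE (t + 1) m.+1 = binomE t m.+1 + binomE t m.
Proof.
rewrite /binomE big_ord_recl subr0 big_ord_recr /=.
have -> : \prod_(i < m) (t + 1 - (bump 0 i)%:R) = \prod_(i < m) (t - i%:R).
  by apply: eq_bigr => i _; rewrite /bump add1n -natr1 [i%:R + 1]addrC addrKA.
have -> : rat_in m`!%:R^-1 = rat_in (m.+1)`!%:R^-1 * m.+1%:R :> E.
  rewrite -(rmorph_nat (@rat_in E)) -rmorphM factS natrM invfM mulrAC.
  by rewrite mulVf ?mul1r// pnatr_eq0.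
rewrite -natr1; ring.
Qed.

(** Replaces a truncation depending on [w] by a fixed partial sum, to which ring operations
    apply. *)
Lemma series_powE g t N w : g [::] = 1 -> (size w < N)%N ->
  series_pow g t w =
  (\sum_(m < N) series_const n (binomE t m) * (g - 1) ^+ m) w.
Proof.
move=> g1 wN; have g0 : (g - 1) [::] = 0 by rewrite seriesD seriesN g1 subrr.
rewrite series_sum -(subnKC wN) big_split_ord /= [X in _ = _ + X]big1 ?addr0.
  by apply: eq_bigr => m _; rewrite series_constMl.
by move=> m _; rewrite series_constMl (order_geX g0) ?mulr0// addSn ltnS leq_addr.
Qed.

Lemma series_pow0 g : series_pow g 0 = 1.
Proof.
apply/funext => w; rewrite /series_pow big_ord_recl binomE0 expr0 mul1r.
rewrite big1 ?addr0// => i _.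
by rewrite /binomE big_ord_recl subr0 mul0r mulr0 mul0r.
Qed.

Lemma series_powD1 g t : g [::] = 1 -> series_pow g (t + 1) = g * series_pow g t.
Proof.
(* Multiplication by [g - 1] shifts the index by one, so the sum for [t + 1] takes one term more
   than [S]; Pascal's rule then matches the terms. *)
move=> g1; apply/funext => w; rewrite (@series_powE g _ (size w).+2)//.
pose S : series n E :=
  \sum_(m < (size w).+1) series_const n (binomE t m) * (g - 1) ^+ m.
transitivity ((g * S) w); last first.
  by apply: eq_seriesM => // u uw; rewrite (@series_powE g _ (size w).+1).
have constC c (f : series n E) : series_const n c * f = f * series_const n c.
  by apply/funext => u; rewrite series_constMl series_constMr mulrC.
have -> : (g * S) w = S w + ((g - 1) * S) w.
  by rewrite mulrBl mul1r seriesD seriesN addrC subrK.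
rewrite big_ord_recl seriesD.
under eq_bigr => i _ do rewrite lift0 binomE_pascal.
rewrite series_sum.
have -> : S w = series_pow g t w by rewrite (@series_powE g t (size w).+1).
rewrite (@series_powE g t (size w).+2)// [in RHS]big_ord_recl seriesD !binomE0 -addrA.
congr (_ + _); rewrite series_sum /S mulr_sumr series_sum -big_split /=.
apply: eq_bigr => i _; rewrite !series_constMl mulrDl; congr (_ + _).
by rewrite mulrA -constC -mulrA -exprS series_constMl.
Qed.

(** The terms with exponent at least 2 start in degree [2 m] or higher. *)
Lemma series_pow_lead g t m w : (0 < m)%N -> order_ge m (g - 1) -> size w = m ->
  series_pow g t w = t * (g - 1) w.
Proof.
move=> m0 gm wm; rewrite /series_pow wm -(prednK m0) 2!big_ord_recl.
rewrite expr0 series1E -size_eq0 wm -(prednK m0) mulr0 add0r lift0 binomE1 expr1.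
rewrite big1 ?addr0// => i _; rewrite !lift0 exprS exprS.
rewrite (@order_geM _ _ m m) ?mulr0//; last by rewrite wm -addn1 leq_add.
by rewrite -[X in order_ge X]addn0; exact: order_geM.
Qed.

(** By [series_powD1] the binomial series at an integer is the group power, reached by induction in
    both directions from 0. *)
Lemma series_pow_int (H : set (Fr n E)) x (k : int) : is_subgroup H -> H x ->
  exists2 y, H y & \val y = series_pow (\val x) k%:~R.
Proof.
move=> [H1 HM HV] Hx; have x1 : (\val x) [::] = 1 by have [] := FrP x.
elim/int_rect: k => [|k [y Hy yE]|k [y Hy yE]].
- by exists 1%g; rewrite // series_pow0.
- exists (x * y)%g; first exact: HM.
  by rewrite val_FrM yE -series_powD1// -!pmulrn natr1.
- exists (x^-1 * y)%g; first by apply: HM => //; exact: HV.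
  rewrite val_FrM val_FrV yE; have -> : (- k%:Z)%:~R = (- k.+1%:Z)%:~R + 1 :> E.
    by rewrite !rmorphN /= -!pmulrn -natr1 opprD subrK.
  by rewrite series_powD1// mulrA series_mulVf// mul1r.
Qed.

End Powers.

(** * Factorisation *)

Section LyndonLevels.
Variables (n m : nat).
Implicit Types (L : seq 'I_n).

(** Taken as a tail of the ordered list, so that the ordered product splits off this level
    directly. *)
Definition lyndon_level : seq (seq 'I_n) :=
  drop (size (lyndon_words n m)) (lyndon_words n m.+1).

Lemma lyndon_words_level :
  lyndon_words n m.+1 = lyndon_words n m ++ lyndon_level.
Proof.
by rewrite /lyndon_level; have [s -> _] := lyndon_wordsS n m; rewrite drop_size_cat.
Qed.

Lemma mem_lyndon_level L :
  (L \in lyndon_level) = lyndon L && (size L == m.+1).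
Proof.
apply/idP/andP => [Ls|[Ll /eqP Lm]].
  have : L \in lyndon_words n m.+1 by rewrite lyndon_words_level mem_cat Ls orbT.
  rewrite mem_lyndon_words => /andP[-> _]; split=> //.
  move: Ls; rewrite /lyndon_level; have [s -> /allP ss] := lyndon_wordsS n m.
  by rewrite drop_size_cat//; exact: ss.
have : L \in lyndon_words n m.+1 by rewrite mem_lyndon_words Ll Lm leqnn.
by rewrite lyndon_words_level mem_cat mem_lyndon_words Ll Lm ltnn.
Qed.

Lemma lyndon_level_sorted : sorted (@word_lt n) lyndon_level.
Proof.
have := lyndon_words_sorted n m.+1; rewrite lyndon_words_level => /cat_sorted2[_].
apply: (@sub_in_sorted _ (fun L => size L == m.+1)).
  by move=> u v /eqP um /eqP vm; rewrite /word_llt um vm ltnn eqxx.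
by apply/allP => L; rewrite mem_lyndon_level => /andP[].
Qed.

End LyndonLevels.

(** * The closure of the free subgroup and successive division by Lyndon factors *)

Section FreeClosure.
Variables (n : nat) (E : topRatRingType) (hE : hausdorff_space E).
Implicit Types (f g h : series n E) (t : seq 'I_n -> E) (L w : seq 'I_n).

(** The closure is taken among all series, where the partial products live; [closure_val] relates it
    to the one in [Fr]. *)
Definition free_closure : set (series n E) :=
  closure [set \val x | x in free_subgroup n E].

Definition Zbar_grouplike h : Prop := grouplike h /\ Zbar_series h.

Lemma Zbar_grouplikeM f g :
  Zbar_grouplike f -> Zbar_grouplike g -> Zbar_grouplike (f * g).
Proof. by move=> [? ?] [? ?]; split; [exact: grouplikeM|exact: Zbar_seriesM]. Qed.

Lemma Zbar_grouplikeV f : Zbar_grouplike f -> Zbar_grouplike (series_inv f).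
Proof. by move=> [? ?]; split; [exact: grouplikeV|exact: Zbar_seriesV]. Qed.

Lemma free_subgroup_is_subgroup : is_subgroup (free_subgroup n E).
Proof.
split; first by move=> A [[A1 _ _] _].
- by move=> x y Hx Hy A AP; case: (AP) => -[_ AM _] _; apply: AM; [exact: Hx|exact: Hy].
- by move=> x Hx A AP; case: (AP) => -[_ _ AV] _; apply: AV; exact: Hx.
Qed.

Lemma free_subgroup_gen j : free_subgroup n E (Fr_gen E j).
Proof. by move=> A [_]; apply; exists j. Qed.

Lemma Xi_free L : free_subgroup n E (Xi (@Fr_gen n E) L).
Proof.
have [H1 HM HV] := free_subgroup_is_subgroup.
rewrite /Xi; move: (size L) => k; elim: k L => [|k IHk] [|a [|b L]];
  try exact: H1; try exact: free_subgroup_gen.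
by rewrite Xi_recS; apply: (HM); [exact: HV|apply: (HM); [exact: HV|exact: HM]].
Qed.

Lemma free_subgroup_Zbar x : free_subgroup n E x -> Zbar_series (\val x).
Proof.
move=> /(_ [set y | Zbar_series (\val y)]); apply; split; last first.
  move=> _ [j _ <-] w; apply: ZbarD; first exact: Zbar_series1.
  by rewrite /series_var; case: ifP => _; [exact: Zbar1|exact: Zbar0].
split; first exact: Zbar_series1.
- by move=> y z Zy Zz; exact: Zbar_seriesM.
- by move=> y Zy; exact: Zbar_seriesV.
Qed.

Lemma free_closure_Zbar f : free_closure f -> Zbar_grouplike f.
Proof.
move=> Cf; split.
  by apply: (grouplike_closed hE); apply: closureS Cf => _ [x _ <-]; exact: FrP.
move=> w; apply: closed_closure.
have := closure_image (@series_coef_continuous n E w) Cf; apply: closureS.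
by move=> _ [_ [x Hx <-] <-]; exact: free_subgroup_Zbar.
Qed.

Lemma free_closureM f g : free_closure f -> free_closure g -> free_closure (f * g).
Proof.
apply: (@closure_op2 (series n E) (fun a b => a * b)).
  exact: series_mul_continuous.
have [_ HM _] := free_subgroup_is_subgroup.
by move=> _ _ [x Hx <-] [y Hy <-]; exists (x * y)%g => //; exact: HM.
Qed.

Lemma free_closure_pow x s : free_subgroup n E x -> Zbar s ->
  free_closure (series_pow (\val x) s).
Proof.
move=> Hx /(closure_image (@series_pow_continuous E n (\val x))).
apply: closureS => _ [_ [k _ <-] <-].
by have [y Hy yE] := series_pow_int k free_subgroup_is_subgroup Hx; exists y.
Qed.

Lemma free_closure_lyndon_prod t m :
  (forall L, lyndon L -> Zbar (t L)) -> free_closure (lyndon_prod t m).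
Proof.
move=> tZ; rewrite /lyndon_prod big_seq; apply: big_ind.
- by apply: subset_closure; exists 1%g => //; case: free_subgroup_is_subgroup.
- exact: free_closureM.
- move=> L; rewrite mem_lyndon_words => /andP[Ll _].
  by apply: free_closure_pow; [exact: Xi_free|exact: tZ].
Qed.

(* In lowest degree, Xi_L contributes L plus larger words, so t_L is read off as
   the coefficient at L of what remains after the previous factors have been
   divided out. *)
Lemma lyndon_factor_words m (s : seq (seq 'I_n)) h : (0 < m)%N ->
    sorted (@word_lt n) s -> all (fun L => lyndon L && (size L == m)) s ->
    Zbar_grouplike h -> order_ge m (h - 1) ->
  exists t h', [/\ forall L, Zbar (t L), Zbar_grouplike h' /\ order_ge m (h' - 1),
    h = (\prod_(L <- s) series_pow (\val (Xi (@Fr_gen n E) L)) (t L)) * h',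
    forall L, L \in s -> h' L = 0 &
    forall w, size w = m -> all (word_lt w) s -> h' w = h w].
Proof.
move=> m0; elim: s h => [|L s IHs] h.
  move=> _ _ hD hm; exists (fun=> 0), h; split=> //; first by move=> L; exact: Zbar0.
  by rewrite big_nil mul1r.
move=> Ls /= /andP[/andP[Ll /eqP Lm] sl] hD hm.
have Lmin := order_path_min (@word_lt_trans n) Ls.
set X := \val (Xi (@Fr_gen n E) L).
have Xm : order_ge m (X - 1) by rewrite -Lm; apply: Xi_order; rewrite Lm.
have qC : free_closure (series_pow X (h L)).
  by apply: free_closure_pow; [exact: Xi_free|case: hD].
have qm : order_ge m (series_pow X (h L) - 1) by exact: series_pow_order.
set q := series_pow X (h L) in qC qm.
have qD := free_closure_Zbar qC; have q1 : q [::] = 1 by case: qD => -[].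
pose h1 := series_inv q * h.
have hE1 : h = q * h1 by rewrite mulrA series_mulfV// mul1r.
have h1D : Zbar_grouplike h1 by apply: Zbar_grouplikeM => //; exact: Zbar_grouplikeV.
have h1m : order_ge m (h1 - 1) by apply: order_geM1 => //; exact: order_geV1.
(* In degree [m] the coefficients of [q] and [h1] add up. Hence the division clears the coefficient
   at [L] and keeps those at smaller words. *)
have h1E w : size w = m -> ~~ word_lt L w -> h w = h L * (w == L)%:R + h1 w.
  move=> wm Lw; rewrite {1}hE1 (order_geM1_lead m0 qm h1m wm).
  by rewrite /q (series_pow_lead _ m0 Xm wm) Xi_lead// wm.
have h1L : h1 L = 0.
  have := h1E L Lm; rewrite word_ltxx eqxx mulr1 => /(_ isT)/esym/eqP.
  by rewrite -subr_eq0 addrAC subrr add0r => /eqP.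
have [t [h' [tZ [h'D h'm] hE2 h's h'w]]] := IHs h1 (path_sorted Ls) sl h1D h1m.
exists (fun K => if K == L then h L else t K), h'; split=> //.
- by move=> K; case: ifP => _; [case: hD|exact: tZ].
- rewrite big_cons eqxx -mulrA [LHS]hE1; congr (_ * _); rewrite hE2; congr (_ * _).
  apply: eq_big_seq => K Ks; case: eqP => // KL.
  by move/allP: Lmin => /(_ K Ks); rewrite KL word_ltxx.
(* As [L] is below all words of [s], the later divisions leave its cleared coefficient unchanged. *)
- move=> K; rewrite inE => /predU1P[->|]; last exact: h's.
  by rewrite h'w.
- move=> w wm /andP[wL ws]; rewrite h'w// (h1E w wm) ?word_ltNgt//.
  by case: eqP wL => [->|_ _]; rewrite ?word_ltxx// mulr0 add0r.
Qed.

(** Division clears the Lyndon words of length [m.+1]; by [grouplike_lyndon_eq0] the whole degree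
    then vanishes. *)
Lemma lyndon_factor_level m h : Zbar_grouplike h -> order_ge m.+1 (h - 1) ->
  exists t h', [/\ forall L, Zbar (t L), Zbar_grouplike h', order_ge m.+2 (h' - 1) &
    h = (\prod_(L <- lyndon_level n m)
      series_pow (\val (Xi (@Fr_gen n E) L)) (t L)) * h'].
Proof.
move=> hD hm; have sl : all (fun L => lyndon L && (size L == m.+1)) (lyndon_level n m).
  by apply/allP => L; rewrite mem_lyndon_level.
have [t [h' [tZ [h'D h'm] hE1 h's _]]] :=
  lyndon_factor_words (ltn0Sn m) (lyndon_level_sorted n m) sl hD hm.
exists t, h'; split=> //; apply: grouplike_lyndon_eq0 => //; first by case: h'D.
by move=> L Ll Lm; apply: h's; rewrite mem_lyndon_level Ll Lm eqxx.
Qed.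

Lemma lyndon_factorization g : Zbar_grouplike g ->
  exists2 t, forall L, Zbar (t L) & lyndon_prod t @ \oo --> g.
Proof.
move=> gD.
(* The hypotheses on the remainder are moved under the existential, so that the division step
   becomes a total function that can be iterated. *)
have /choice[F FP] : forall x : nat * series n E,
    exists p : (seq 'I_n -> E) * series n E,
    Zbar_grouplike x.2 -> order_ge x.1.+1 (x.2 - 1) ->
    [/\ forall L, Zbar (p.1 L), Zbar_grouplike p.2, order_ge x.1.+2 (p.2 - 1) &
      x.2 = (\prod_(L <- lyndon_level n x.1)
        series_pow (\val (Xi (@Fr_gen n E) L)) (p.1 L)) * p.2].
  move=> [m h] /=.
  have [[hD hm]|hN] := pselect (Zbar_grouplike h /\ order_ge m.+1 (h - 1)).
    by have [t [h' ?]] := lyndon_factor_level hD hm; exists (t, h').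
  by exists (fun=> 0, 0) => hD hm; case: hN.
(* [H m] is what remains of [g] after dividing out the factors with words of length at most [m]. *)
pose H := fix H m := if m is k.+1 then (F (k, H k)).2 else g.
have HP m : Zbar_grouplike (H m) /\ order_ge m.+1 (H m - 1).
  elim: m => [|m [HD Hm]]; last by have [] := FP (m, H m) HD Hm.
  by split=> //= -[|//] _; rewrite seriesD seriesN; case: gD => -[-> _]; rewrite subrr.
(* Words of length [k.+1] are treated at stage [k], hence the predecessor. *)
pose t L := (F ((size L).-1, H (size L).-1)).1 L.
exists t => [L|].
  by have [HD Hm] := HP (size L).-1; have [tZ _ _ _] := FP (_, _) HD Hm; exact: tZ.
have gE m : g = lyndon_prod t m * H m.
  elim: m => [|m IHm].
    rewrite /lyndon_prod (_ : lyndon_words n 0 = [::]) ?big_nil ?mul1r//.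
    case E0: (lyndon_words n 0) => [//|L s].
    have : L \in lyndon_words n 0 by rewrite E0 mem_head.
    rewrite mem_lyndon_words leqn0 => /andP[/lyndon_neq0 L0].
    by rewrite size_eq0 (negbTE L0).
  have [HD Hm] := HP m; have [_ _ _ HE] := FP (m, H m) HD Hm.
  rewrite {1}IHm [H m]HE /lyndon_prod lyndon_words_level big_cat /= -mulrA.
  congr (_ * (_ * _)); apply: eq_big_seq => L.
  by rewrite mem_lyndon_level /t => /andP[_ /eqP ->].
(* The remainder [H m] agrees with 1 up to degree [m], so the partial product already has the
   coefficients of [g] there. *)
apply: series_cvg_near => w; exists (size w) => m wm.
rewrite [in RHS](gE m) -[in LHS](mulr1 (lyndon_prod t m)).
apply: eq_seriesM => // u uw; have [_ Hm] := HP m.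
have /eqP := Hm u (leq_ltn_trans (leq_trans uw wm) (ltnSn m)).
by rewrite seriesD seriesN subr_eq0 => /eqP.
Qed.

End FreeClosure.

Theorem corollary3p5 (R : realType) (n : nat) (E : topRatRingType)
    (hn : (1 <= n)%N) (hE : metrizable R E) :
  closure (free_subgroup n E) = Fr_Zbar n E
  /\
  [set \val g | g in closure (free_subgroup n E)] =
  [set p : series n E | exists2 t : seq 'I_n -> E,
     (forall L, lyndon L -> Zbar (t L)) & lyndon_prod t @ \oo --> p].
Proof.
have hausE := metrizable_hausdorff hE.
have prodC p : (exists2 t : seq 'I_n -> E, (forall L, lyndon L -> Zbar (t L)) &
    lyndon_prod t @ \oo --> p) -> free_closure p.
  move=> [t tZ tp]; apply: closed_closure; apply: closure_cvg tp => m.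
  exact: free_closure_lyndon_prod.
have Cprod p : Zbar_grouplike p -> exists2 t : seq 'I_n -> E,
    (forall L, lyndon L -> Zbar (t L)) & lyndon_prod t @ \oo --> p.
  by move=> /(lyndon_factorization hausE)[t tZ tp]; exists t.
(* All inclusions follow from a cycle: the closure lies in the group-like series over [Zbar], these
   are limits of products by [Cprod], and such limits lie in the closure by [prodC]. *)
split; apply/seteqP; split.
- by move=> g /closure_val/(free_closure_Zbar hausE)[].
- by move=> g gZ; apply/closure_val/prodC/Cprod; split=> //; exact: FrP.
- by move=> _ [g /closure_val Cg <-]; apply/Cprod; exact: free_closure_Zbar.
- move=> p /prodC Cp; have [pG _] := free_closure_Zbar hausE Cp.
  by exists (mkFr pG) => //; apply/closure_val.
Qed.
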